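(* The group $T_{xz}$ is simple.
   Context: Let $\tau=(\sqrt5-1)/2$, so $1=\tau+\tau^2$. $V_\tau$ is the group (under composition, $fg=f\circ g$) of left-continuous piecewise-linear bijections of $(0,1]$ with finitely many breakpoints (including discontinuities), all in $\mathbb Z[\tau]$, and all slopes integer powers of $\tau$. $T_\tau$ is the subgroup of those elements of $V_\tau$ which induce orientation-preserving homeomorphisms of the circle obtained from $[0,1]$ by identifying $0$ and $1$. Trees. An $x$-caret subdivides an interval $(a,a+L]$ into $(a,a+\tau^2L]$ and $(a+\tau^2L,a+L]$; a $y$-caret subdivides it into $(a,a+\tau L]$ and $(a+\tau L,a+L]$. A tree is a finite rooted binary tree whose interior nodes (carets) are each of type $x$ or $y$; with root $(0,1]$, its leaves, ordered from left to right, give a subdivision of $(0,1]$. A triple $(T_1,\pi,T_2)$, with $T_1,T_2$ trees with $k$ leaves and $\pi$ a permutation of the $k$ leaf positions, represents the element of $V_\tau$ mapping the interval of leaf $i$ of $T_2$ affinely and increasingly onto the interval of leaf $\pi(i)$ of $T_1$. Generators. The spine $S_m$ is the tree with $m$ $x$-carets, each one after the first attached to the right leg of the previous one; its leaves are numbered $0,1,\dots,m$ from left to right. For $n\ge0$, $x_n$ (resp. $y_n$) is the element $(T,\mathrm{id},S_{n+2})$, where $T$ is obtained from $S_{n+1}$ by attaching an $x$-caret (resp. a $y$-caret) to its leaf number $n$. For $n\ge1$, $c_n=(S_{n+1},\gamma,S_{n+1})$, where $\gamma$ is the cyclic permutation sending leaf $0$ to leaf $n+1$ and leaf $i$ to leaf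 $i-1$ for $1\le i\le n+1$. The elements $x_n,y_n,c_n$ generate $T_\tau$. There is a (unique) surjective homomorphism $\varphi:T_\tau\to\mathbb Z/2\mathbb Z$ with $\varphi(x_n)=\varphi(c_n)=0$ and $\varphi(y_n)=1$ for all $n$. $T_{xz}$ denotes the kernel of $\varphi$. *)

(* Defs.v *)
From HB Require Import structures.
From mathcomp Require Import all_boot all_order all_fingroup all_algebra.
From mathcomp Require Import all_classical all_reals all_analysis.
From mathcomp Require Import ring lra.

Set Implicit Arguments.
Unset Strict Implicit.
Unset Printing Implicit Defensive.

Import Order.TTheory GRing.Theory Num.Theory.
Import numFieldNormedType.Exports.

Local Open Scope classical_set_scope.
Local Open Scope ring_scope.

(* Subgroups are boolean predicates; classically these are all subsets. *)
Definition normal_in (gT : groupType) (N K : {pred gT}) : Prop :=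
  [/\ group_closed N, {subset N <= K}
    & forall x y : gT, x \in K -> y \in N -> (y ^ x)%g \in N].

Definition simple_subgroup (gT : groupType) (K : {pred gT}) : Prop :=
  [/\ group_closed K, ~ (K =i pred1 (1 : gT)%g)
    & forall N : {pred gT}, normal_in N K -> N =i pred1 1%g \/ N =i K].

Definition tau (R : realType) : R := (Num.sqrt 5 - 1) / 2.

(* As tau ^+ 2 = 1 - tau, the ring Z[tau] is Z + Z tau. *)
Definition in_Ztau (R : realType) (x : R) : Prop :=
  exists a b : int, x = a%:~R + b%:~R * tau R.

Definition unitI (R : realType) : Type := {x : R | 0 < x <= 1}.
HB.instance Definition _ (R : realType) := Choice.on (unitI R).
HB.instance Definition _ (R : realType) := SubType.on (unitI R).

(* The left-continuous piecewise-linear self-maps of (0,1], with finitely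
   many breakpoints (the list s), all in Z[tau], and slopes powers of tau.
   Away from s the map is affine, and left-continuity is the fact that the
   affine formula valid on ]u, v[ also holds at v. *)
Definition tau_PL (R : realType) (f : unitI R -> unitI R) : Prop :=
  exists s : seq R, {in s, forall b, in_Ztau b} /\
    forall u v : R, 0 <= u -> u < v -> v <= 1 ->
      {in s, forall b, ~~ (u < b < v)} ->
      exists (k : int) (c : R), forall x : unitI R,
        u < val x <= v -> val (f x) = tau R ^ k * val x + c.

Definition in_Vtau (R : realType) (f : unitI R -> unitI R) : Prop :=
  bijective f /\ tau_PL f.

(* A point of the circle [0,1]/(0 ~ 1) is identified with its unique
   representative in (0,1].  U is open in the quotient topology when its
   preimage in [0,1], which contains 0 exactly when U contains the point 1,
   is the trace on [0,1] of an open set O of the real line. *)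
Definition circle_open (R : realType) (U : set (unitI R)) : Prop :=
  exists O : set R, [/\ open O, forall x : unitI R, O (val x) <-> U x
    & forall x : unitI R, val x = 1 -> (O 0 <-> U x)].

Definition circle_homeo (R : realType) (f : unitI R -> unitI R) : Prop :=
  [/\ bijective f,
      forall U, circle_open U -> circle_open (f @^-1` U)
    & forall U, circle_open U -> circle_open (f @` U)].

(* cyc x y z: the points x, y, z are distinct and are met in this order when
   the circle is travelled in the positive direction. *)
Definition cyc (R : realType) (x y z : unitI R) : bool :=
  [|| val x < val y < val z, val y < val z < val x
    | val z < val x < val y].

Definition circle_orientation_preserving (R : realType)
    (f : unitI R -> unitI R) : Prop :=
  forall x y z, cyc x y z -> cyc (f x) (f y) (f z).

Definition in_Ttau (R : realType) (f : unitI R -> unitI R) : Prop :=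
  [/\ in_Vtau f, circle_homeo f & circle_orientation_preserving f].

Record Ttau (R : realType) := MkTtau {
  Tfun :> unitI R -> unitI R;
  TfunP : `[< in_Ttau Tfun >] }.

HB.instance Definition _ (R : realType) := [isSub for @Tfun R].
HB.instance Definition _ (R : realType) := [Choice of Ttau R by <:].

Lemma Ttau_in (R : realType) (f : Ttau R) : in_Ttau f.
Proof. exact/asboolP/TfunP. Qed.

Section Ztau.
Variable R : realType.
Implicit Types (x y : R) (k : int).
Local Notation tau := (tau R).

Lemma tau_gt0 : 0 < tau.
Proof.
have h : 1 < Num.sqrt (5 : R) by rewrite -{1}sqrtr1 ltr_sqrt; lra.
by rewrite /Defs.tau; lra.
Qed.

Lemma tau_sqr : tau * tau = 1 - tau.
Proof.
have h : Num.sqrt (5 : R) * Num.sqrt 5 = 5 by rewrite -expr2 sqr_sqrtr; lra.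
rewrite /Defs.tau; move: (Num.sqrt 5) h => q h.
have -> : (q - 1) / 2 * ((q - 1) / 2) = (q * q - 2 * q + 1) / 4 by field.
by rewrite h; field.
Qed.

Lemma tauX_gt0 k : 0 < tau ^ k.
Proof. exact: exprz_gt0 tau_gt0. Qed.

Lemma Ztau0 : in_Ztau (0 : R).
Proof. by exists 0, 0; rewrite mulr0z mul0r addr0. Qed.

Lemma Ztau1 : in_Ztau (1 : R).
Proof. by exists 1, 0; rewrite mulr0z mul0r addr0. Qed.

Lemma ZtauD x y : in_Ztau x -> in_Ztau y -> in_Ztau (x + y).
Proof.
by move=> [a [b ->]] [c [d ->]]; exists (a + c), (b + d); rewrite !rmorphD /=; ring.
Qed.

Lemma ZtauN x : in_Ztau x -> in_Ztau (- x).
Proof. by move=> [a [b ->]]; exists (- a), (- b); rewrite !rmorphN /=; ring. Qed.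

Lemma ZtauB x y : in_Ztau x -> in_Ztau y -> in_Ztau (x - y).
Proof. by move=> hx /ZtauN; apply: ZtauD. Qed.

Lemma ZtauM x y : in_Ztau x -> in_Ztau y -> in_Ztau (x * y).
Proof.
move=> [a [b ->]] [c [d ->]]; exists (a * c + b * d), (a * d + b * c - b * d).
rewrite !(rmorphD, rmorphB, rmorphM) /=.
have -> : forall p q r s : R, (p + q * tau) * (r + s * tau)
   = p * r + (p * s + q * r) * tau + q * s * (tau * tau) by move=> *; ring.
by rewrite tau_sqr; ring.
Qed.

Lemma Ztau_tauX k : in_Ztau (tau ^ k).
Proof.
have ht : in_Ztau tau by exists 0, 1; rewrite mul1r add0r.
have hV : in_Ztau tau^-1.
  exists 1, 1; rewrite mul1r; apply: (mulIf (lt0r_neq0 tau_gt0)).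
  rewrite mulVf ?(lt0r_neq0 tau_gt0)// mulrDl mul1r tau_sqr.
  by rewrite addrC subrK.
have hX x n : in_Ztau x -> in_Ztau (x ^+ n).
  move=> hx; elim: n => [|n IH]; first by rewrite expr0; exact: Ztau1.
  by rewrite exprS; exact: ZtauM.
case: k => n; first exact: hX.
by rewrite NegzE -exprnN -exprVn; exact: hX.
Qed.

End Ztau.

Section Pieces.
Variable R : realType.
Local Notation tau := (tau R).
Local Notation I := (unitI R).
Implicit Types (f g : I -> I) (p q : R * R) (L : seq (R * R)).

Let mem_piece p (x : R) := p.1 < x <= p.2.

Let subdivision L :=
  [/\ forall p, p \in L -> [/\ 0 <= p.1, p.1 < p.2, p.2 <= 1,
                 in_Ztau p.1 & in_Ztau p.2],
      forall x : R, 0 < x <= 1 -> exists2 p : R * R, p \in L & mem_piece p x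
    & forall p q x, p \in L -> q \in L -> mem_piece p x -> mem_piece q x ->
        p = q].

Let subdivision_ex (s : seq R) : {in s, forall b, in_Ztau b} ->
  exists2 L, subdivision L &
    forall p b, p \in L -> b \in s -> ~~ (p.1 < b < p.2).
Proof.
elim: s => [_|b s IH hs].
  exists [:: (0, 1)] => //; split.
  - move=> p; rewrite inE => /eqP -> /=; split; rewrite ?lexx ?ltr01 //.
      exact: Ztau0.
    exact: Ztau1.
  - by move=> x hx; exists (0, 1); rewrite ?inE.
  - by move=> p q x; rewrite !inE => /eqP -> /eqP ->.
have hb : in_Ztau b by apply: hs; rewrite mem_head.
have [L [L1 L2 L3] L4] : exists2 L, subdivision L &
    forall p b, p \in L -> b \in s -> ~~ (p.1 < b < p.2).
  by apply: IH => c hc; apply: hs; rewrite inE hc orbT.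
pose F p := if p.1 < b < p.2 then [:: (p.1, b); (b, p.2)] else [:: p].
have FE p q : q \in F p -> ((p.1 < b < p.2) /\ (q = (p.1, b) \/ q = (b, p.2)))
    \/ (~~ (p.1 < b < p.2) /\ q = p).
  rewrite /F; case: ifP => h; rewrite !inE.
    by move=> /orP[] /eqP ->; left; split => //; [left|right].
  by move=> /eqP ->; right; split.
have Fsub p q x : q \in F p -> mem_piece q x -> mem_piece p x.
  rewrite /mem_piece => /FE[[/andP[h1 h2] [->|->]]|[_ ->]] //= /andP[h3 h4];
    apply/andP; split => //; lra.
exists (flatten (map F L)).
  split.
  - move=> q /flatten_mapP[p pL /FE].
    have [h0 h1 h2 h3 h4] := L1 _ pL.
    by move=> [[/andP[h5 h6] [->|->]]|[_ ->]] /=; split => //; lra.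
  - move=> x /L2[p pL px].
    case: (boolP (p.1 < b < p.2)) => h; last first.
      by exists p => //; apply/flatten_mapP; exists p; rewrite // /F (negbTE h) inE.
    case: (lerP x b) => hx.
      exists (p.1, b); last by move: px; rewrite /mem_piece /= hx => /andP[->].
      by apply/flatten_mapP; exists p; rewrite // /F h !inE eqxx.
    exists (b, p.2); last by move: px; rewrite /mem_piece /= hx => /andP[_ ->].
    by apply/flatten_mapP; exists p; rewrite // /F h !inE eqxx orbT.
  - move=> q q' x /flatten_mapP[p pL qp] /flatten_mapP[p' pL' qp'] qx qx'.
    have E : p = p' by apply: (L3 _ _ x) => //; [exact: Fsub qx|exact: Fsub qx'].
    subst p'; move: qx qx'; rewrite /mem_piece.
    case/FE: qp => -[h]; case/FE: qp' => -[h'].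
    - by move=> [->|->] [->|->] //= /andP[? ?] /andP[? ?]; exfalso; lra.
    - by rewrite h in h'.
    - by rewrite h' in h.
    - by move=> -> ->.
move=> q c /flatten_mapP[p pL /FE qp]; rewrite inE => /orP[/eqP ->|cs].
  case: qp => [[h [->|->]]|[h ->]] //=; first by rewrite ltxx andbF.
  by rewrite ltxx.
have := L4 _ _ pL cs; apply: contra.
case: qp => [[/andP[h1 h2] [->|->]]|[h ->]] //= /andP[h3 h4];
  apply/andP; split => //; lra.
Qed.

Let inI (x : R) (h : 0 < x <= 1) : I := exist _ x h.

(* A bijection in V_tau is given by finitely many affine pieces whose
   translation parts also lie in Z[tau]. *)
Let pieces f (L : seq (R * R)) (k : R * R -> int) (c : R * R -> R) :=
  subdivision L /\ forall p, p \in L ->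
    [/\ in_Ztau (c p), 0 <= tau ^ k p * p.1 + c p,
        tau ^ k p * p.2 + c p <= 1
      & forall x : I, mem_piece p (val x) -> val (f x) = tau ^ k p * val x + c p].

Let pieces_ex f : in_Vtau f -> exists L k c, pieces f L k c.
Proof.
move=> [fbij [s [hs fs]]].
have [L Ls Lav] := subdivision_ex hs.
have [L1 L2 L3] := Ls.
have [kc kcP] : exists kc : R * R -> int * R, forall p, p \in L ->
    forall x : I, mem_piece p (val x) -> val (f x) = tau ^ (kc p).1 * val x + (kc p).2.
  suff /choice[kc kcP] : forall p : R * R, exists kc : int * R, p \in L ->
      forall x : I, mem_piece p (val x) -> val (f x) = tau ^ kc.1 * val x + kc.2.
    by exists kc.
  move=> p.
  case: (boolP (p \in L)) => pL; last by exists (0, 0).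
  have [h0 h1 h2 h3 h4] := L1 _ pL.
  have [|k [c kcP]] := fs _ _ h0 h1 h2; first by move=> b bs; exact: Lav.
  by exists (k, c) => _ x; exact: kcP.
pose k p := (kc p).1; pose c p := (kc p).2.
pose al p := tau ^ k p * p.1 + c p.
have fE p (x : I) : p \in L -> mem_piece p (val x) -> val (f x) = tau ^ k p * val x + c p.
  by move=> pL; exact: kcP.
have al_ge0 p : p \in L -> 0 <= al p.
  move=> pL; have [h0 h1 h2 _ _] := L1 _ pL; have t0 := tauX_gt0 R (k p).
  rewrite leNgt; apply/negP => alt0.
  pose x := Num.min p.2 (p.1 - al p / tau ^ k p).
  have d0 : 0 < - al p / tau ^ k p by rewrite divr_gt0 // oppr_gt0.
  have x1 : p.1 < x by rewrite /x lt_min h1 /=; lra.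
  have x2 : x <= p.2 by rewrite /x ge_min lexx.
  have x3 : x <= p.1 - al p / tau ^ k p by rewrite /x ge_min lexx orbT.
  have hx : 0 < x <= 1 by apply/andP; split; lra.
  have := fE p (inI hx) pL; rewrite /mem_piece /= x1 x2 => /(_ isT) E.
  have /andP[f0 _] := valP (f (inI hx)).
  have : tau ^ k p * (x - p.1) <= tau ^ k p * (- al p / tau ^ k p).
    by rewrite ler_pM2l //; lra.
  by rewrite mulrCA divff ?gt_eqF // mulr1; rewrite /= in E f0; rewrite /al in alt0 *; nra.
have be_le1 p : p \in L -> tau ^ k p * p.2 + c p <= 1.
  move=> pL; have [h0 h1 h2 _ _] := L1 _ pL.
  have hx : 0 < p.2 <= 1 by apply/andP; split; lra.
  have := fE p (inI hx) pL; rewrite /mem_piece /= h1 lexx => /(_ isT) <-.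
  by have /andP[] := valP (f (inI hx)).
have [g fK gK] := fbij.
have step p : p \in L -> al p != 0 ->
    exists q, [/\ q \in L, al q < al p & al p = tau ^ k q * q.2 + c q].
  move=> pL ap; have := al_ge0 _ pL.
  rewrite le_eqVlt eq_sym (negbTE ap) /= => {ap}ap0.
  have b1 := be_le1 _ pL; have [h0 h1 h2 _ _] := L1 _ pL.
  have t0 := tauX_gt0 R (k p).
  have ab : al p < tau ^ k p * p.2 + c p by rewrite /al ltrD2r ltr_pM2l.
  have ha : 0 < al p <= 1 by rewrite ap0 /=; lra.
  have [q qL gq] := L2 _ (valP (g (inI ha))).
  have := fE _ _ qL gq; rewrite gK /= => E.
  have u0 := tauX_gt0 R (k q).
  have [j0 j1 j2 _ _] := L1 _ qL.
  case/andP: (gq) => gq1 gq2.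
  have aq : al q < al p by rewrite [al p]E /al ltrD2r ltr_pM2l.
  exists q; split => //; apply/eqP; rewrite eq_le; apply/andP; split.
    by rewrite E lerD2r ler_pM2l.
  rewrite leNgt; apply/negP => lt_aq.
  pose y := Num.min (tau ^ k p * p.2 + c p) (tau ^ k q * q.2 + c q).
  have y1 : al p < y by rewrite /y lt_min ab lt_aq.
  have y2 : y <= tau ^ k p * p.2 + c p by rewrite /y ge_min lexx.
  have y3 : y <= tau ^ k q * q.2 + c q by rewrite /y ge_min lexx orbT.
  have pre r : r \in L -> al r < y -> y <= tau ^ k r * r.2 + c r ->
      exists2 x : I, mem_piece r (val x) & val (f x) = y.
    move=> rL r1 r2; have [i0 i1 i2 _ _] := L1 _ rL.
    have v0 := tauX_gt0 R (k r).
    pose x := (y - c r) / tau ^ k r.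
    have x1 : r.1 < x by rewrite /x ltr_pdivlMr // mulrC ltrBrDr.
    have x2 : x <= r.2 by rewrite /x ler_pdivrMr // [r.2 * _]mulrC lerBlDr.
    have hx : 0 < x <= 1 by apply/andP; split; lra.
    have m : mem_piece r x by rewrite /mem_piece x1 x2.
    exists (inI hx) => //; rewrite (fE r) //= /x mulrCA divff ?gt_eqF //.
    by rewrite mulr1 subrK.
  have [x xp fx] := pre p pL y1 y2.
  have [x' xq fx'] := pre q qL (lt_trans aq y1) y3.
  have xx : x = x' by apply: (can_inj fK); apply: val_inj; rewrite fx fx'.
  rewrite -xx in xq; move: aq; have -> : q = p by apply: (L3 _ _ (val x)).
  by rewrite ltxx.
have ltn_count (a b : pred (R * R)) q (s0 : seq (R * R)) : subpred a b ->
    q \in s0 -> b q -> ~~ a q -> (count a s0 < count b s0)%N.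
  move=> sab + bq aq; elim: s0 => //= r s0 IHs.
  rewrite inE => /orP[/eqP <-|/IHs lt_s].
    by rewrite bq (negbTE aq) /= add0n add1n ltnS sub_count.
  by have := sab r; case: (a r) => [/(_ isT) ->|_]; rewrite -?addnS leq_add.
have alZ n : forall p, p \in L ->
    (count (fun q => al q < al p : bool)%R L < n)%N -> in_Ztau (al p).
  elim: n => [//|n IH] p pL hc.
  have [->|ap] := eqVneq (al p) 0; first exact: Ztau0.
  have [q [qL aq E]] := step p pL ap.
  have [h0 h1 h2 h3 h4] := L1 _ qL.
  have Zq : in_Ztau (al q).
    apply: IH => //; apply: leq_trans (hc : (_ <= n)%N).
    by apply: (ltn_count _ _ q) => //; rewrite ?ltxx // => r /lt_trans; apply.
  have -> : al p = al q + tau ^ k q * (q.2 - q.1) by rewrite E /al; ring.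
  by apply: ZtauD => //; apply: ZtauM; [exact: Ztau_tauX | exact: ZtauB].
exists L, k, c; split => // p pL; have [h0 h1 h2 h3 h4] := L1 _ pL.
split; [|exact: al_ge0|exact: be_le1|by move=> x; exact: fE].
have -> : c p = al p - tau ^ k p * p.1 by rewrite /al; ring.
apply: ZtauB; first exact: (alZ _ _ pL (ltnSn _)).
by apply: ZtauM => //; exact: Ztau_tauX.
Qed.

Lemma Vtau_id : in_Vtau (@id I).
Proof.
split; first by exists id.
exists [::]; split=> // u v _ _ _ _; exists 0, 0 => x _.
by rewrite expr0z mul1r addr0.
Qed.

Lemma Vtau_comp f g : in_Vtau f -> in_Vtau g -> in_Vtau (f \o g).
Proof.
move=> [fbij [s [hs fs]]] gV; have [gbij _] := gV.
have [L [k [c [Ls gE]]]] := pieces_ex gV; have [L1 L2 L3] := Ls.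
split; first exact: bij_comp.
exists ([seq p.1 | p <- L] ++ [seq (b - c p) * tau ^ (- k p) | p <- L, b <- s]).
split=> [b|u v u0 uv v1 av].
  rewrite mem_cat => /orP[/mapP[p pL ->]|/allpairsP[[p b'] /= [pL bs ->]]].
    by case: (L1 _ pL).
  have [cZ _ _ _] := gE _ pL.
  by apply: ZtauM; [apply: ZtauB => //; exact: hs | exact: Ztau_tauX].
have hv : 0 < v <= 1 by apply/andP; split; lra.
have [p pL /andP[pv1 pv2]] := L2 _ hv.
have pu : p.1 <= u.
  rewrite leNgt; apply/negP => up; suff /av : p.1 \in
      [seq p.1 | p <- L] ++ [seq (b - c p) * tau ^ (- k p) | p <- L, b <- s].
    by rewrite up pv1.
  by rewrite mem_cat map_f.
have [cZ a0 b1 gp] := gE _ pL; have t0 := tauX_gt0 R (k p).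
have inv z : tau ^ (- k p) * (tau ^ k p * z) = z.
  by rewrite -invr_expz mulKf // gt_eqF.
have [||||k' [c' fE]] := fs (tau ^ k p * u + c p) (tau ^ k p * v + c p).
- by apply: le_trans a0 _; rewrite lerD2r ler_pM2l.
- by rewrite ltrD2r ltr_pM2l.
- by apply: le_trans b1; rewrite lerD2r ler_pM2l.
- move=> b bs; have := av ((b - c p) * tau ^ (- k p)).
  rewrite mem_cat; have -> : (b - c p) * tau ^ (- k p)
      \in [seq (b - c p) * tau ^ (- k p) | p <- L, b <- s].
    by apply/allpairsP; exists (p, b).
  rewrite orbT => /(_ isT); apply: contra => /andP[bu bv].
  by rewrite -invr_expz ltr_pdivlMr // ltr_pdivrMr // ltrBrDr ltrBlDr
    ![_ * tau ^ _]mulrC bu bv.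
exists (k' + k p), (tau ^ k' * c p + c') => x /andP[xu xv].
have E : val (g x) = tau ^ k p * val x + c p.
  by apply: gp; rewrite /mem_piece; apply/andP; split; lra.
rewrite /= fE E; last by rewrite ltrD2r lerD2r ltr_pM2l // ler_pM2l // xu xv.
by rewrite expfzDr ?gt_eqF ?tau_gt0 // mulrDr mulrA addrA.
Qed.

Lemma Vtau_inv f g : cancel f g -> cancel g f -> in_Vtau f -> in_Vtau g.
Proof.
move=> fK gK fV; have [L [k [c [Ls fE]]]] := pieces_ex fV.
have [L1 L2 L3] := Ls.
split; first by exists f.
exists [seq tau ^ k p * p.1 + c p | p <- L].
split=> [b /mapP[p pL ->]|u v u0 uv v1 av].
  have [_ _ _ pZ _] := L1 _ pL; have [cZ _ _ _] := fE _ pL.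
  by apply: ZtauD => //; apply: ZtauM => //; exact: Ztau_tauX.
have hv : 0 < v <= 1 by apply/andP; split; lra.
have [p pL gp] := L2 _ (valP (g (inI hv))); have /andP[gp1 gp2] := gp.
have [cZ a0 b1 fp] := fE _ pL; have t0 := tauX_gt0 R (k p).
have [h0 h1 h2 _ _] := L1 _ pL.
have := fp _ gp; rewrite gK /= => Ev.
have av' : tau ^ k p * p.1 + c p < v by rewrite Ev ltrD2r ltr_pM2l.
have au : tau ^ k p * p.1 + c p <= u.
  rewrite leNgt; apply/negP => ua; have := av _ (map_f _ pL).
  by rewrite ua av'.
exists (- k p), (- (tau ^ (- k p) * c p)) => y /andP[yu yv].
pose x := (val y - c p) / tau ^ k p.
have x1 : p.1 < x.
  by rewrite /x ltr_pdivlMr // mulrC ltrBrDr; apply: le_lt_trans yu.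
have x2 : x <= p.2.
  rewrite /x ler_pdivrMr // lerBlDr [p.2 * _]mulrC; apply: le_trans yv _.
  by rewrite {1}Ev lerD2r ler_pM2l.
have hx : 0 < x <= 1 by apply/andP; split; lra.
have E : f (inI hx) = y.
  apply: val_inj; rewrite fp /mem_piece /= ?x1 ?x2 //.
  by rewrite /x mulrCA divff ?gt_eqF // mulr1 subrK.
by rewrite -{1}E fK /= /x -invr_expz mulrC mulrBr.
Qed.

End Pieces.

Section TtauGroup.
Variable R : realType.
Local Notation I := (unitI R).
Implicit Types (f g : I -> I).

Lemma Ttau_id_in : in_Ttau (@id I).
Proof.
split; [exact: Vtau_id|split=> [|U|U]|by []]; first by exists id.
  by rewrite preimage_id.
by rewrite image_id.
Qed.

Lemma Ttau_comp_in f g : in_Ttau f -> in_Ttau g -> in_Ttau (f \o g).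
Proof.
move=> [fV [fb fo fo'] fc] [gV [gb go go'] gc]; split.
- exact: Vtau_comp.
- split; first exact: bij_comp.
    by move=> U /fo /go.
  by move=> U /go' /fo'; rewrite image_comp.
- by move=> x y z /gc /fc.
Qed.

Lemma Ttau_inv_in f g :
  cancel f g -> cancel g f -> in_Ttau f -> in_Ttau g.
Proof.
move=> fK gK [fV [fb fo fo'] fc]; split; first exact: Vtau_inv fV.
- split; first by exists f.
  + move=> U /fo'; congr circle_open; apply/seteqP; split=> x /=.
      by move=> [y Uy <-]; rewrite fK.
    by move=> Ugx; exists (g x).
  + move=> U /fo; congr circle_open; apply/seteqP; split=> x /=.
      by move=> Ufx; exists (f x).
    by move=> [y Uy <-]; rewrite gK.
- move=> x y z xyz; apply/negPn/negP => Nxyz.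
  suff : cyc (g x) (g z) (g y).
    by move=> /fc; rewrite !gK; move: xyz; rewrite /cyc => /or3P[] /andP[? ?]
      /or3P[] /andP[? ?]; lra.
  have ne a b : val a < val b -> val (g a) != val (g b).
    by move=> ab; apply: contraTneq ab => /val_inj /(can_inj gK) ->; rewrite ltxx.
  have [n1 n2 n3] : [/\ val (g x) != val (g y), val (g y) != val (g z)
                      & val (g x) != val (g z)].
    by case/or3P: xyz => /andP[h1 h2]; have h3 := lt_trans h1 h2;
      split; first [exact: ne | by rewrite eq_sym; exact: ne].
  move: n1 n2 n3 Nxyz; rewrite /cyc.
  move: (val (g x)) (val (g y)) (val (g z)) => a b c.
  by case: (ltgtP a b) => //; case: (ltgtP b c) => //; case: (ltgtP a c).
Qed.

Definition Ttau_one : Ttau R := MkTtau (asboolT Ttau_id_in).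

(* fg is f after g. *)
Definition Ttau_mul (f g : Ttau R) : Ttau R :=
  MkTtau (asboolT (Ttau_comp_in (Ttau_in f) (Ttau_in g))).

Lemma Ttau_inv_ex (f : Ttau R) :
  exists g : Ttau R, cancel f g /\ cancel g f.
Proof.
have [_ [[g fK gK] _ _] _] := Ttau_in f.
by exists (MkTtau (asboolT (Ttau_inv_in fK gK (Ttau_in f)))).
Qed.

Definition Ttau_inv (f : Ttau R) : Ttau R := projT1 (cid (Ttau_inv_ex f)).

Lemma Ttau_ext (f g : Ttau R) : f =1 g -> f = g.
Proof. by move=> fg; apply: val_inj; apply/funext. Qed.

Lemma Ttau_mulA : associative Ttau_mul.
Proof. by move=> f g h; exact: Ttau_ext. Qed.

Lemma Ttau_mul1 : left_id Ttau_one Ttau_mul.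
Proof. by move=> f; exact: Ttau_ext. Qed.

Lemma Ttau_mulr1 : right_id Ttau_one Ttau_mul.
Proof. by move=> f; exact: Ttau_ext. Qed.

Lemma Ttau_mulV : left_inverse Ttau_one Ttau_inv Ttau_mul.
Proof.
by move=> f; apply: Ttau_ext => x; rewrite /Ttau_inv; case: cid => g [/= fK _].
Qed.

Lemma Ttau_mulrV : right_inverse Ttau_one Ttau_inv Ttau_mul.
Proof.
by move=> f; apply: Ttau_ext => x; rewrite /Ttau_inv; case: cid => g [/= _ gK].
Qed.

End TtauGroup.

HB.instance Definition _ (R : realType) := isGroup.Build (Ttau R)
  (@Ttau_mulA R) (@Ttau_mul1 R) (@Ttau_mulr1 R) (@Ttau_mulV R) (@Ttau_mulrV R).

Lemma TtauM (R : realType) (f g : Ttau R) x : (f * g)%g x = f (g x).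
Proof. by []. Qed.

Inductive caret := Xcaret | Ycaret.

Inductive tree := Leaf | Node of caret & tree & tree.

Fixpoint nleaves (t : tree) : nat :=
  if t is Node _ l r then (nleaves l + nleaves r)%N else 1%N.

(* The subdivision of ]a, b] given by t, each ]u, v] encoded as (u, v). *)
Fixpoint leaves (R : realType) (t : tree) (a b : R) : seq (R * R) :=
  if t is Node ca l r then
    let m := a + (if ca is Xcaret then tau R ^+ 2 else tau R) * (b - a) in
    leaves l a m ++ leaves r m b
  else [:: (a, b)].

Definition leaf_itv (R : realType) (t : tree) (i : nat) : R * R :=
  nth (0, 0) (leaves t 0 1) i.

(* f is the element of V_tau represented by the triple (T1, pi, T2). *)
Definition represents (R : realType) (k : nat) (T1 : tree) (pi : 'S_k)
    (T2 : tree) (f : unitI R -> unitI R) : Prop :=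
  [/\ nleaves T1 = k, nleaves T2 = k
    & forall (i : 'I_k) (x : unitI R),
        let: (a, b) := leaf_itv R T2 i in
        let: (a', b') := leaf_itv R T1 (pi i) in
        a < val x <= b ->
        val (f x) = a' + (b' - a') / (b - a) * (val x - a)].

Fixpoint spine (m : nat) : tree :=
  if m is m'.+1 then Node Xcaret Leaf (spine m') else Leaf.

(* t with a caret of type ca attached to its leaf number n *)
Fixpoint attach (ca : caret) (t : tree) (n : nat) : tree :=
  match t with
  | Leaf => Node ca Leaf Leaf
  | Node ca' l r =>
      if (n < nleaves l)%N then Node ca' (attach ca l n) r
      else Node ca' l (attach ca r (n - nleaves l))
  end.

Definition is_x (R : realType) (n : nat) (f : unitI R -> unitI R) : Prop :=
  represents (attach Xcaret (spine n.+1) n) (1%g : 'S_n.+3) (spine n.+2) f.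

Definition is_y (R : realType) (n : nat) (f : unitI R -> unitI R) : Prop :=
  represents (attach Ycaret (spine n.+1) n) (1%g : 'S_n.+3) (spine n.+2) f.

(* [ord_pred] sends 0 to n.+1 and i to i - 1 otherwise. *)
Definition is_c (R : realType) (n : nat) (f : unitI R -> unitI R) : Prop :=
  represents (spine n.+1) (perm (@ord_pred_inj n.+2)) (spine n.+1) f.

Definition Txz (R : realType) (phi : Ttau R -> 'Z_2) : {pred Ttau R} :=
  [pred f | phi f == 0].

(* Main.v *)
Require Import Defs.
From HB Require Import structures.
From mathcomp Require Import all_boot all_order all_fingroup all_algebra.
From mathcomp Require Import all_classical all_reals all_analysis.
From mathcomp Require Import generic_quotient ring lra zify.

(** Write G for [Ttau R], K for the kernel of [phi], and let N be a normal
    subgroup of K containing some [n <> 1].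

    As [n] displaces an interval, the classical commutator trick shows that N
    contains every G-conjugate of a commutator of two elements of G that are
    trivial near the base point 0 ~ 1 of the circle ([local_commutators]).  The
    elements all of whose G-conjugates are in N form a normal subgroup M of G
    with M <= N <= K.  If M has index at most two in G then N = K, because
    [phi] is onto; so everything rests on [index_two], a statement on
    abelianizations.

    The elements trivial near the base point and their conjugates by one
    rotation generate G ([Ttau_generated]), so the former are the ones to
    understand modulo M.  They are best seen inside a larger group: let [PL R]
    be the group of piecewise linear maps of the half line that are trivial
    near 0, with breakpoints in Z[tau] and slopes powers of [tau].  Near +oo
    such a map is affine, and the kernel of the germ at +oo, with values in
    the group Aff of the maps x |-> tau^k x + c with c in Z[tau], is the
    subgroup C of compactly supported maps.  Any element of C can be conjugated
    into the unit interval, and those that land in M form a normal subgroup Z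
    of [PL R] containing [[C, PL R]]: thus [PL R / Z] is a central extension of
    Aff by C / Z.  The claim becomes that C / Z has order at most two
    ([compact_mod_two]).

    Commutators of lifts of translations define an alternating bilinear form on
    Z[tau] with values in the centre, determined by its value c on the pair
    (1, tau).  Conjugation by a lift of the homothety of ratio [tau] fixes c,
    but turns the pair (1, tau) into (tau, tau^2) = (tau, 1 - tau), on which
    the form takes the value c^-1; hence c^2 = 1.  Modulo c the lifts of
    translations form an abelian group A, on which the homothety acts by an
    automorphism s.  As tau^2 + tau - 1 = 0, the endomorphism s^2 + s - 1 maps
    A into C / Z, on which it is the identity as s is trivial there.  It
    extends to a homomorphism on [PL R] that is trivial on the kinks, which
    generate.  So the identity of C / Z modulo c is trivial, that is, C / Z is
    generated by c. *)

Set Implicit Arguments.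
Unset Strict Implicit.
Unset Printing Implicit Defensive.

Import Order.TTheory GRing.Theory Num.Theory.
Import numFieldNormedType.Exports.
Local Open Scope classical_set_scope.
Local Open Scope ring_scope.

Local Ltac between := apply/andP; split; lra.

(** * Quotient groups *)

Section Quotient.
Local Open Scope group_scope.
Local Open Scope quotient_scope.
Variables (gT : groupType) (N : {pred gT}).
Hypothesis N_group : group_closed N.
Hypothesis N_norm : forall x y : gT, y \in N -> y ^ x \in N.

Let rel_mod (x y : gT) : bool := x * y^-1 \in N.

Let rel_mod_refl : reflexive rel_mod.
Proof. by move=> x; rewrite /rel_mod mulgV N_group.1. Qed.

Let rel_mod_sym : symmetric rel_mod.
Proof.
by move=> x y; apply/idP/idP => /(group_closedV N_group); rewrite invgF.
Qed.

Let rel_mod_trans : transitive rel_mod.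
Proof.
move=> y x z xy yz; have := group_closedM N_group xy yz.
by rewrite mulgA mulgVK.
Qed.

Definition equiv_mod := EquivRel rel_mod rel_mod_refl rel_mod_sym rel_mod_trans.
Definition coset_type := {eq_quot equiv_mod}.

Local Notation Q := coset_type.

HB.instance Definition _ := Choice.on Q.
HB.instance Definition _ := EqQuotient.on Q.

Let piE x y : (\pi_Q x = \pi_Q y) <-> rel_mod x y.
Proof. by split=> [/eqquotP|?]; [|exact/eqquotP]. Qed.

Let mulQ (a b : Q) : Q := \pi_Q (repr a * repr b).
Let invQ (a : Q) : Q := \pi_Q (repr a)^-1.

Let repr_pi x : repr (\pi_Q x) * x^-1 \in N.
Proof. by have /piE : \pi_Q (repr (\pi_Q x)) = \pi_Q x by rewrite reprK. Qed.

Let mulQE x y : mulQ (\pi_Q x) (\pi_Q y) = \pi_Q (x * y).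
Proof.
apply/piE; rewrite /rel_mod.
have Nx := repr_pi x; have Ny := repr_pi y.
have := group_closedM N_group Nx (N_norm x^-1 Ny).
by rewrite conjgE invgK invgM !mulgA mulgVK.
Qed.

Let invQE x : invQ (\pi_Q x) = \pi_Q x^-1.
Proof.
apply/piE; rewrite /rel_mod.
have := N_norm x (group_closedV N_group (repr_pi x)).
by rewrite conjgE invgM !invgK !mulgA mulVg mul1g.
Qed.

Let piQ_surj (a : Q) : exists x, a = \pi_Q x.
Proof. by exists (repr a); rewrite reprK. Qed.

Let mulQA : associative mulQ.
Proof.
move=> a b c; have [[x ->] [y ->] [z ->]] := And3 (piQ_surj a) (piQ_surj b) (piQ_surj c).
by rewrite !mulQE mulgA.
Qed.
Let mul1Q : left_id (\pi_Q 1) mulQ.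
Proof. by move=> a; have [x ->] := piQ_surj a; rewrite mulQE mul1g. Qed.
Let mulQ1 : right_id (\pi_Q 1) mulQ.
Proof. by move=> a; have [x ->] := piQ_surj a; rewrite mulQE mulg1. Qed.
Let mulVQ : left_inverse (\pi_Q 1) invQ mulQ.
Proof. by move=> a; have [x ->] := piQ_surj a; rewrite invQE mulQE mulVg. Qed.
Let mulQV : right_inverse (\pi_Q 1) invQ mulQ.
Proof. by move=> a; have [x ->] := piQ_surj a; rewrite invQE mulQE mulgV. Qed.

HB.instance Definition _ := isGroup.Build Q mulQA mul1Q mulQ1 mulVQ mulQV.

(** Congruences modulo a normal subgroup become equalities in a group. *)
Lemma quotient_group_exists : exists (E : groupType) (chi : gT -> E),
  {morph chi : x y / x * y} /\ (forall x, chi x = 1 <-> x \in N).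
Proof.
exists Q, \pi_Q; split=> [x y|x]; first by rewrite -mulQE.
by split=> [/piE|xN]; [|apply/piE]; rewrite /rel_mod divg1.
Qed.

End Quotient.

(** * Piecewise linear maps of the half line *)

Section TauPowers.
Variable R : realType.
Implicit Types (x : R) (k m : int).
Local Notation tau := (tau R).

Lemma tau_lt1 : tau < 1.
Proof. by have := tau_sqr R; have := tau_gt0 R; nra. Qed.

Lemma tau_neq0 : tau != 0.
Proof. by rewrite gt_eqF ?tau_gt0. Qed.

Lemma tauXD k m : tau ^ (k + m) = tau ^ k * tau ^ m.
Proof. by rewrite expfzDr // tau_neq0. Qed.

Lemma tauXK k x : tau ^ (- k) * (tau ^ k * x) = x.
Proof. by rewrite mulrA -tauXD addNr expr0z mul1r. Qed.

Lemma tauXVK k x : tau ^ k * (tau ^ (- k) * x) = x.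
Proof. by rewrite mulrA -tauXD addrN expr0z mul1r. Qed.

Lemma tauX_inj k m : tau ^ k = tau ^ m -> k = m.
Proof.
suff lt a b : a < b -> tau ^ b < tau ^ a.
  by case: (ltgtP k m) => // /lt h e; rewrite e ltxx in h.
move=> ab; have -> : b = a + (b - a) by ring.
rewrite tauXD gtr_pMr ?tauX_gt0 //.
have /gtz0_abs <- : 0 < b - a by rewrite subr_gt0.
have : (`|b - a| > 0)%N by rewrite absz_gt0 subr_eq0 gt_eqF.
case: `|b - a|%N => // n _.
rewrite -exprnP exprn_ilt1 ?tau_lt1 //; exact/ltW/tau_gt0.
Qed.

Lemma tauX_small x : 0 < x -> exists n : nat, tau ^+ n < x.
Proof.
move=> x0; have /cvgrPdist_lt /(_ _ x0)[n _ nP] : (fun n => tau ^+ n) @ \oo --> (0 : R).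
  by apply: cvg_expr; rewrite ger0_norm ?tau_lt1 // ltW // tau_gt0.
exists n; have := nP n (leqnn n); rewrite /= sub0r normrN.
by rewrite ger0_norm // exprn_ge0 // ltW // tau_gt0.
Qed.

Lemma Ztau_tauXn n : in_Ztau (tau ^+ n).
Proof. exact: (Ztau_tauX R n). Qed.

Lemma Ztau_tau : in_Ztau tau.
Proof. exact: (Ztau_tauX R 1). Qed.

Lemma Ztau_int k : in_Ztau (k%:~R : R).
Proof. by exists k, 0; rewrite mul0r addr0. Qed.

(** The integer multiples of a power of [tau] smaller than [y - x] cannot all
    avoid the interval. *)
Lemma Ztau_dense (x y : R) : x < y -> exists2 z, in_Ztau z & x < z < y.
Proof.
move=> xy; have [n nP] : exists n, tau ^+ n < y - x by apply: tauX_small; lra.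
have t0 : 0 < tau ^+ n by rewrite exprn_gt0 ?tau_gt0.
exists ((Num.floor (x / tau ^+ n) + 1)%:~R * tau ^+ n).
  by apply: ZtauM; [exact: Ztau_int | exact: Ztau_tauXn].
have /andP[f1 f2] := real_floor_itv (num_real (x / tau ^+ n)).
rewrite -ltr_pdivrMr // f2 /=.
apply: le_lt_trans (_ : x + tau ^+ n < _); last by lra.
by rewrite rmorphD /= mulrDl mul1r lerD2r -ler_pdivlMr.
Qed.

End TauPowers.

Section PLgroup.
Variable R : realType.
Local Notation tau := (tau R).

(** The generators: trivial up to [a], then of slope [tau ^ k]. *)
Definition kink (a : R) (k : int) (x : R) : R :=
  if x <= a then x else a + tau ^ k * (x - a).

Lemma kink_le a k x : x <= a -> kink a k x = x.
Proof. by rewrite /kink => ->. Qed.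

Lemma kink_ge a k x : a <= x -> kink a k x = a + tau ^ k * (x - a).
Proof.
move=> h2; rewrite /kink; case: (leP x a) => // h1.
by rewrite (le_anti (introT andP (conj h1 h2))) subrr mulr0 addr0.
Qed.

Lemma kink_gt a k x : a < x -> a < kink a k x.
Proof. by move=> ax; rewrite kink_ge ?ltW // ltrDl mulr_gt0 ?tauX_gt0 ?subr_gt0. Qed.

Lemma kinkM a k m : kink a k \o kink a m = kink a (k + m).
Proof.
apply/funext => x /=; case: (leP x a) => [h|h]; first by rewrite !kink_le ?kink_le.
rewrite (kink_ge _ (ltW (kink_gt _ h))) !kink_ge ?ltW //.
by rewrite [a + _ - a]addrC addKr tauXD mulrA.
Qed.

Lemma kink0 a : kink a 0 = id.
Proof. by apply/funext=> x; rewrite /kink expr0z mul1r addrC subrK; case: ifP. Qed.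

Lemma kinkK a k x : kink a k (kink a (- k) x) = x.
Proof. by rewrite -[LHS]/((_ \o _) _) kinkM addrN kink0. Qed.

Lemma kinkVK a k x : kink a (- k) (kink a k x) = x.
Proof. by rewrite -[LHS]/((_ \o _) _) kinkM addNr kink0. Qed.

Lemma kink_lt a k x y : x < y -> kink a k x < kink a k y.
Proof.
move=> xy; case: (leP y a) => [h|h]; first by rewrite !kink_le //; lra.
case: (leP x a) => [h'|h'].
  by rewrite kink_le //; apply: le_lt_trans h' (kink_gt _ h).
by rewrite !kink_ge ?ltW // ltrD2l ltr_pM2l ?tauX_gt0 // ltrD2r.
Qed.

Lemma Ztau_kink a k x : in_Ztau a -> in_Ztau x -> in_Ztau (kink a k x).
Proof.
move=> za zx; rewrite /kink; case: ifP => // _.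
by apply: ZtauD => //; apply: ZtauM; [exact: Ztau_tauX | exact: ZtauB].
Qed.

(** Defining the group by its generators makes closure under composition and
    inversion immediate; that it contains all the piecewise linear maps that
    are needed comes from [PL_extend] and [fix1_PL]. *)
Inductive pl : (R -> R) -> Prop :=
| pl_id : pl id
| pl_kink f a k : pl f -> in_Ztau a -> 0 < a -> pl (f \o kink a k).

Lemma pl_comp f g : pl f -> pl g -> pl (f \o g).
Proof. by move=> pf; elim=> // g' a k _ IH za a0; exact: pl_kink IH za a0. Qed.

Lemma pl1 a k : in_Ztau a -> 0 < a -> pl (kink a k).
Proof. exact: (pl_kink k pl_id). Qed.

Lemma pl_inv f : pl f -> exists g, [/\ pl g, cancel f g & cancel g f].
Proof.
elim=> [|f' a k _ [g [pg fK gK]] za a0]; first by exists id; split=> //; exact: pl_id.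
exists (kink a (- k) \o g); split=> [|x|x] /=.
- exact: pl_comp (pl1 _ za a0) pg.
- by rewrite fK kinkVK.
- by rewrite kinkK gK.
Qed.

Record PL := MkPL { plfun :> R -> R; plP : `[< pl plfun >] }.
HB.instance Definition _ := [isSub for plfun].
HB.instance Definition _ := [Choice of PL by <:].

Implicit Types h g : PL.

Lemma PL_pl h : pl h. Proof. exact/asboolP/plP. Qed.

Definition PL_one : PL := MkPL (asboolT pl_id).
Definition PL_mul h g : PL := MkPL (asboolT (pl_comp (PL_pl h) (PL_pl g))).

Lemma PL_inv_ex h : exists g, cancel h g /\ cancel g h.
Proof. by have [g [pg hK gK]] := pl_inv (PL_pl h); exists (MkPL (asboolT pg)). Qed.

Definition PL_inv h : PL := projT1 (cid (PL_inv_ex h)).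

Lemma PL_ext h g : h =1 g -> h = g.
Proof. by move=> hg; apply: val_inj; apply/funext. Qed.

Let PL_mulA : associative PL_mul. Proof. by move=> ? ? ?; exact: PL_ext. Qed.
Let PL_mul1 : left_id PL_one PL_mul. Proof. by move=> ?; exact: PL_ext. Qed.
Let PL_mulr1 : right_id PL_one PL_mul. Proof. by move=> ?; exact: PL_ext. Qed.
Let PL_mulV : left_inverse PL_one PL_inv PL_mul.
Proof. by move=> h; apply: PL_ext => x; rewrite /PL_inv; case: cid => g [/= hK _]. Qed.
Let PL_mulrV : right_inverse PL_one PL_inv PL_mul.
Proof. by move=> h; apply: PL_ext => x; rewrite /PL_inv; case: cid => g [/= _ gK]. Qed.

HB.instance Definition _ := isGroup.Build PL PL_mulA PL_mul1 PL_mulr1 PL_mulV PL_mulrV.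

Lemma PLM h g x : (h * g)%g x = h (g x). Proof. by []. Qed.
Lemma PL1 x : (1%g : PL) x = x. Proof. by []. Qed.
Lemma PLK h : cancel h (h^-1)%g.
Proof. by move=> x; rewrite -PLM mulVg. Qed.
Lemma PLVK h : cancel (h^-1)%g h.
Proof. by move=> x; rewrite -PLM mulgV. Qed.
Lemma PLJ h g x : (h ^ g)%g x = (g^-1)%g (h (g x)). Proof. by []. Qed.

Lemma PL_ind (P : PL -> Prop) : P 1%g ->
  (forall h g a k, P h -> in_Ztau a -> 0 < a -> g =1 kink a k -> P (h * g)%g) ->
  forall h, P h.
Proof.
move=> P1 PM h; have [f /asboolP pf ef] : exists2 f, `[< pl f >] & f = h.
  by exists h => //; exact: plP.
elim: pf h ef => [|f' a k pf IH za a0] h ef.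
  by have -> : h = 1%g by apply: PL_ext => x; rewrite -ef.
have -> : h = (MkPL (asboolT pf) * MkPL (asboolT (pl1 k za a0)))%g.
  by apply: PL_ext => x; rewrite -ef.
by apply: (PM _ _ a k (IH _ _)).
Qed.

Lemma PL_kink a k : in_Ztau a -> 0 < a -> exists h : PL, h =1 kink a k.
Proof. by move=> za a0; exists (MkPL (asboolT (pl1 k za a0))). Qed.

Lemma PL_lt h x y : x < y -> h x < h y.
Proof.
elim/PL_ind: h x y => // h g a k IH za a0 gE x y xy; rewrite !PLM !gE.
by apply: IH; exact: kink_lt.
Qed.

Lemma PL_ltE h x y : (h x < h y) = (x < y).
Proof.
case: (ltgtP x y) => [/(PL_lt h) -> //|/(PL_lt h)|->]; last by rewrite !ltxx.
by move=> h1; apply/negbTE; rewrite -leNgt ltW.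
Qed.

Lemma PL_leE h x y : (h x <= h y) = (x <= y).
Proof. by rewrite !leNgt PL_ltE. Qed.

Lemma PL_id_near0 h : exists e, [/\ in_Ztau e, 0 < e & forall x, x <= e -> h x = x].
Proof.
elim/PL_ind: h => [|h g a k [e [ze e0 eP]] za a0 gE].
  by exists 1; split=> //; exact: Ztau1.
case: (leP e a) => ea.
  by exists e; split=> // x xe; rewrite PLM gE kink_le ?eP //; lra.
exists a; split=> // x xe; rewrite PLM gE kink_le ?eP //; lra.
Qed.

Lemma PL_gt0 h x : (0 < h x) = (0 < x).
Proof.
have [e [_ e0 eP]] := PL_id_near0 h.
by rewrite -{1}(eP 0 (ltW e0)) PL_ltE.
Qed.

Lemma PL_pieces h : exists2 s : seq R, {in s, forall b, in_Ztau b} &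
  forall u v, u < v -> {in s, forall b, ~~ (u < b < v)} ->
  exists (k : int) (c : R), forall x, u < x <= v -> h x = tau ^ k * x + c.
Proof.
elim/PL_ind: h => [|h g a k [s zs sP] za a0 gE].
  exists [::] => // u v uv _; exists 0, 0 => x _.
  by rewrite PL1 expr0z mul1r addr0.
exists (a :: map (kink a (- k)) s) => [b|u v uv av].
  by rewrite inE => /orP[/eqP-> //|/mapP[c /zs zc ->]]; exact: Ztau_kink.
have av' : {in s, forall b, ~~ (kink a k u < b < kink a k v)}.
  move=> b bs; have := av (kink a (- k) b); rewrite inE (map_f _ bs) orbT => /(_ isT).
  apply: contra => /andP[/(kink_lt a (- k)) h1 /(kink_lt a (- k)) h2].
  by rewrite !kinkVK in h1 h2; rewrite h1 h2.
have [m [c hP]] := sP _ _ (kink_lt a k uv) av'.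
have hg x : u < x <= v -> h (g x) = tau ^ m * kink a k x + c.
  move=> /andP[h1 h2]; rewrite gE hP // kink_lt //=.
  by move: h2; rewrite le_eqVlt => /orP[/eqP -> //|/(kink_lt a k)/ltW].
have := av a (mem_head _ _); rewrite negb_and -!leNgt => /orP[au|va].
  exists (m + k), (tau ^ m * (a - tau ^ k * a) + c) => x /andP[h1 h2].
  by rewrite PLM hg ?h1 // kink_ge ?tauXD; [ring | lra].
exists m, c => x /andP[h1 h2]; rewrite PLM hg ?h1 // kink_le //; lra.
Qed.

(** In a word for [h], the kinks that only act beyond [b] can be dropped, and
    the others are affine from [b] on. *)
Lemma PL_straighten h b : in_Ztau b -> 0 < b -> in_Ztau (h b) /\
  exists (g : PL) (k : int), (forall x, x <= b -> g x = h x) /\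
    (forall x, b <= x -> g x = h b + tau ^ k * (x - b)).
Proof.
elim/PL_ind: h b => [|h g a k IH za a0 gE] b zb b0.
  split=> //; exists 1%g, 0; split=> // x _; rewrite !PL1 expr0z; ring.
case: (leP b a) => ba.
  have [z [g' [m [g1 g2]]]] := IH b zb b0.
  rewrite PLM gE kink_le //; split=> //; exists g', m; split=> // x xb.
  by rewrite g1 // PLM gE kink_le //; lra.
have zb' : in_Ztau (kink a k b) by exact: Ztau_kink.
have b0' : 0 < kink a k b by apply: lt_trans a0 (kink_gt _ ba).
have [z [g' [m [g1 g2]]]] := IH _ zb' b0'.
rewrite PLM gE; split=> //; exists (g' * g)%g, (m + k).
split=> x xb; rewrite !PLM gE.
  rewrite g1 //; move: xb; rewrite le_eqVlt => /orP[/eqP-> //|/(kink_lt a k)/ltW //].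
rewrite g2; last by move: xb; rewrite le_eqVlt => /orP[/eqP-> //|/(kink_lt a k)/ltW].
by rewrite tauXD !kink_ge; [ring | lra | lra].
Qed.

(** The point of this relation is that it is an equivalence compatible with
    sums, because the left end [u] is arbitrary.  As [x] and [tau ^ k * x] are related, so
    are [x = tau x + tau^2 x] and [x + x], and then all positive elements of
    Z[tau] ([stretches1]). *)

Definition stretches (x y : R) := forall u, in_Ztau u -> 0 < u ->
  exists h : PL, (forall z, z <= u -> h z = z) /\
    (forall z, u + x <= z -> h z = z + (y - x)).

Let stretches_trans x y z : stretches x y -> stretches y z -> stretches x z.
Proof.
move=> xy yz u zu u0; have [h [h1 h2]] := xy u zu u0; have [g [g1 g2]] := yz u zu u0.
exists (g * h)%g; split=> t tu; rewrite PLM; first by rewrite h1 // g1.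
by rewrite h2 // g2; lra.
Qed.

Let stretches_sym x y : stretches x y -> stretches y x.
Proof.
move=> xy u zu u0; have [h [h1 h2]] := xy u zu u0.
exists (h^-1)%g; split=> t tu; apply: (can_inj (PLK h)); rewrite PLVK.
  by rewrite h1.
by rewrite h2; lra.
Qed.

Let stretches_add x y x' y' : in_Ztau y -> 0 < y -> stretches x y -> stretches x' y' ->
  0 < x' -> stretches (x + x') (y + y').
Proof.
move=> zy y0 xy xy' x0 u zu u0; have [h [h1 h2]] := xy u zu u0.
have [|g [g1 g2]] := xy' (u + y) (ZtauD zu zy); first by lra.
exists (g * h)%g; split=> t tu; rewrite PLM; first by rewrite h1 // g1; lra.
by rewrite h2 ?g2; lra.
Qed.

Let stretches_tau x k : in_Ztau x -> 0 < x -> stretches x (tau ^ k * x).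
Proof.
move=> zx x0 u zu u0; have [h hE] := PL_kink k zu u0.
have [|g gE] := PL_kink (- k) (ZtauD zu zx); first by lra.
exists (h * g)%g; split=> z zu'; rewrite PLM hE gE.
  by rewrite !kink_le //; lra.
rewrite (kink_ge _ zu') kink_ge; last first.
  by have := tauX_gt0 R (- k); nra.
have -> : u + x + tau ^ (- k) * (z - (u + x)) - u = x + tau ^ (- k) * (z - (u + x)) by ring.
by rewrite mulrDr tauXVK; ring.
Qed.

Let stretches_refl x : stretches x x.
Proof. by move=> u _ _; exists 1%g; split=> z _; rewrite PL1 //; ring. Qed.

Let stretches_double x : in_Ztau x -> 0 < x -> stretches x (x + x).
Proof.
move=> zx x0; have {1}-> : x = tau ^ 1 * x + tau ^ 2 * x.
  rewrite -mulrDl (_ : tau ^ 2 = tau * tau) // tau_sqr expr1z; ring.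
have zt k : in_Ztau (tau ^ k * x) by apply: ZtauM => //; exact: Ztau_tauX.
by apply: stretches_add => //; [apply/stretches_sym/stretches_tau..|
  rewrite mulr_gt0 ?tauX_gt0].
Qed.

Let stretches_nat x n : in_Ztau x -> 0 < x -> stretches x (x *+ n.+1).
Proof.
move=> zx x0; elim: n => [|n IH]; first exact: stretches_refl.
apply: stretches_trans (stretches_double zx x0) _.
by rewrite mulrS; apply: stretches_add.
Qed.

Let stretches1_nat (a b : nat) : 0 < a%:R + b%:R * tau -> stretches 1 (a%:R + b%:R * tau).
Proof.
have t0 := tau_gt0 R; have z1 := Ztau1 R; have zt := Ztau_tau R.
have ht : stretches 1 tau by have := stretches_tau 1 z1 ltr01; rewrite expr1z mulr1.
have tn m : stretches 1 (tau *+ m.+1).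
  exact: stretches_trans ht (stretches_nat _ zt t0).
rewrite mulr_natl; case: a b => [|a] [|b] x0.
- by rewrite mulr0n addr0 ltxx in x0.
- by rewrite add0r.
- by rewrite mulr0n addr0; exact: stretches_nat.
apply: stretches_trans (stretches_double z1 ltr01) _.
apply: stretches_add => //; [|exact: stretches_nat].
by rewrite pmulrn; exact: Ztau_int.
Qed.

(** Every positive element of Z[tau] is, up to a power of [tau], a combination
    of 1 and [tau] with nonnegative coefficients: when the coefficients have
    opposite signs, rewriting [a + b tau] as [tau ((a + b) + a tau)] either
    makes both nonnegative or decreases the sum of their absolute values. *)
Let stretches1 x : in_Ztau x -> 0 < x -> stretches 1 x.
Proof.
move=> [a [b]]; have [n] := ubnP (`|a| + `|b|)%N.
elim: n a b x => // n IH a b x + ->.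
have t0 := tau_gt0 R.
have E (c d : int) : c%:~R + d%:~R * tau = tau ^ 1 * ((c + d)%:~R + c%:~R * tau) :> R.
  by rewrite expr1z [RHS]mulrDr [tau * (_ * tau)]mulrCA tau_sqr rmorphD /=; ring.
have step (c d : int) : in_Ztau ((c + d)%:~R + c%:~R * tau : R) by exists (c + d), c.
case: a => a; case: b => b lt_n x0; rewrite ?NegzE in lt_n x0 *.
- by apply: stretches1_nat.
- rewrite E in x0 *; rewrite pmulr_rgt0 ?tauX_gt0 // in x0.
  apply: stretches_trans (_ : stretches _ _) (stretches_tau _ (step _ _) x0).
  case: (leqP b.+1 a) => ba.
    have D : a%:Z - b.+1%:Z = (a - b.+1)%N%:Z by lia.
    by rewrite D in x0 *; exact: stretches1_nat.
  apply: (IH _ _ _ _ (erefl _) x0); have : (0 < a)%N; last by lia.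
  case: (posnP a) => // a0; rewrite a0 in x0; move: x0.
  rewrite mul0r addr0 ltr0z; lia.
- rewrite E in x0 *; rewrite pmulr_rgt0 ?tauX_gt0 // in x0.
  apply: stretches_trans (_ : stretches _ _) (stretches_tau _ (step _ _) x0).
  have D : (- a.+1%:Z)%:~R < 0 :> R by rewrite ltrz0; lia.
  apply: (IH _ _ _ _ (erefl _) x0); have : (a.+1 < b)%N; last by lia.
  rewrite ltnNge; apply/negP => ba; move: x0; apply/negP; rewrite -leNgt.
  have : (- a.+1%:Z + b%:Z)%:~R <= 0 :> R by rewrite lerz0; lia.
  by nra.
- exfalso; move: x0; apply/negP; rewrite -leNgt.
  have : (- a.+1%:Z)%:~R <= 0 :> R by rewrite lerz0; lia.
  have : (- b.+1%:Z)%:~R <= 0 :> R by rewrite lerz0; lia.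
  by nra.
Qed.

Lemma PL_extend u v w k : in_Ztau u -> in_Ztau v -> in_Ztau w ->
  0 < u -> u < v -> u < w ->
  exists h : PL, (forall x, x <= u -> h x = x) /\
    (forall x, v <= x -> h x = w + tau ^ k * (x - v)).
Proof.
move=> zu zv zw u0 uv uw.
have s : stretches (v - u) (w - u).
  apply: stretches_trans (stretches_sym (stretches1 _ _)) (stretches1 _ _);
    rewrite ?subr_gt0 //; exact: ZtauB.
have [h [h1 h2]] := s u zu u0.
have [|g gE] := PL_kink k zv; first by lra.
exists (h * g)%g; split=> x xu; rewrite PLM gE.
  by rewrite kink_le ?h1 //; lra.
have t0 : 0 <= tau ^ k * (x - v) by rewrite mulr_ge0 ?subr_ge0 // ltW ?tauX_gt0.
by rewrite kink_ge // h2; lra.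
Qed.

(** Straighten [h] at [b], then undo the resulting affine map between [b] and
    [c]. *)
Lemma PL_truncate h b c : in_Ztau b -> 0 < b -> b < c -> h b < c ->
  exists g : PL, (forall x, x <= b -> g x = h x) /\ (forall x, c <= x -> g x = x).
Proof.
move=> zb b0 bc hbc.
have [zhb [h' [k [h1 h2]]]] := PL_straighten h zb b0.
have [|c' zc' /andP[mc cc]] := Ztau_dense (_ : Num.max b (h b) < c).
  by rewrite gt_max bc hbc.
move: mc; rewrite gt_max => /andP[bc' hbc'].
have zh : in_Ztau (h' c').
  by have [|] := PL_straighten h' zc'; first by lra.
have hb : h' b = h b by rewrite h1.
have [|||e [e1 e2]] := @PL_extend (h b) (h' c') c' (- k) zhb zh zc'.
- by rewrite PL_gt0.
- by rewrite -hb PL_ltE.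
- by rewrite //.
exists (e * h')%g; split=> x xb; rewrite PLM.
  by rewrite e1 ?h1 // PL_leE.
rewrite e2; last by rewrite PL_leE; lra.
rewrite !h2; try lra.
have -> : h b + tau ^ k * (x - b) - (h b + tau ^ k * (c' - b)) = tau ^ k * (x - c') by ring.
by rewrite tauXK; ring.
Qed.

End PLgroup.

(** * Germs at infinity and the central extension of the affine group *)

Section Germs.
Variable R : realType.
Local Notation tau := (tau R).
Implicit Types (h g t s : PL R) (k m n : int) (c d : R).

Definition germ h k c :=
  in_Ztau c /\ exists M, forall x, M <= x -> h x = tau ^ k * x + c.

Lemma germ_exists h : exists k c, germ h k c.
Proof.
elim/PL_ind: h => [|h g a m [k [c [zc [M hM]]]] za a0 gE].
  by exists 0, 0; split; [exact: Ztau0 | exists 0 => x _; rewrite PL1 expr0z; ring].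
exists (k + m), (tau ^ k * (a - tau ^ m * a) + c); split.
  apply: ZtauD => //; apply: ZtauM; first exact: Ztau_tauX.
  by apply: ZtauB => //; apply: ZtauM => //; exact: Ztau_tauX.
exists (Num.max a (a + tau ^ (- m) * (M - a))) => x; rewrite ge_max => /andP[ax Mx].
have t0 := tauX_gt0 R m.
rewrite PLM gE kink_ge // hM ?tauXD; first by ring.
have : tau ^ m * (tau ^ (- m) * (M - a)) <= tau ^ m * (x - a) by rewrite ler_pM2l //; lra.
by rewrite tauXVK; lra.
Qed.

Lemma germ_uniq h k c m d : germ h k c -> germ h m d -> k = m /\ c = d.
Proof.
move=> [_ [M hM]] [_ [M' hM']]; pose x := Num.max M M'.
have Mx : M <= x by rewrite le_max lexx.
have Mx' : M' <= x by rewrite le_max lexx orbT.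
have e0 : tau ^ k * x + c = tau ^ m * x + d by rewrite -hM // hM'.
have e1 : tau ^ k * (x + 1) + c = tau ^ m * (x + 1) + d.
  by rewrite -hM ?hM' //; lra.
have e : tau ^ k = tau ^ m by lra.
by split; [exact: tauX_inj e | rewrite e in e0; lra].
Qed.

Lemma germ1 : germ 1%g 0 0.
Proof. by split; [exact: Ztau0 | exists 0 => x _; rewrite PL1 expr0z; ring]. Qed.

Lemma germM h g k c m d : germ h k c -> germ g m d ->
  germ (h * g)%g (k + m) (tau ^ k * d + c).
Proof.
move=> [zc [M hM]] [zd [M' gM]]; split.
  by apply: ZtauD => //; apply: ZtauM => //; exact: Ztau_tauX.
exists (Num.max M' (tau ^ (- m) * (M - d))) => x; rewrite ge_max => /andP[ax Mx].
rewrite PLM gM // hM ?tauXD; first by ring.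
rewrite -lerBlDr -(tauXVK m (M - d)) ler_pM2l //; exact: tauX_gt0.
Qed.

Lemma germV h k c : germ h k c -> germ (h^-1)%g (- k) (- (tau ^ (- k) * c)).
Proof.
move=> [zc [M hM]]; split.
  by apply/ZtauN/ZtauM => //; exact: Ztau_tauX.
exists (tau ^ k * M + c) => y My; apply: (can_inj (PLK h)); rewrite PLVK hM.
  by rewrite mulrDr tauXVK mulrN tauXVK; ring.
have -> : M = tau ^ (- k) * (tau ^ k * M + c) - tau ^ (- k) * c.
  by rewrite mulrDr tauXK; ring.
by rewrite lerD2r ler_pM2l // tauX_gt0.
Qed.

Lemma germJ t g k c d : germ t 0 d -> germ g k c -> germ (t ^ g)%g 0 (tau ^ (- k) * d).
Proof.
move=> gt gg; have := germM (germV gg) (germM gt gg).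
rewrite add0r addNr expr0z mul1r mulrDr.
by congr germ; ring.
Qed.

(** As the elements of [PL R] are trivial near 0, a trivial germ at infinity
    means compact support. *)
Definition shift h := exists c, germ h 0 c.
Definition compact_supp h := germ h 0 0.

Lemma compact_shift h : compact_supp h -> shift h.
Proof. by exists 0. Qed.

Lemma germM0 h g c d : germ h 0 c -> germ g 0 d -> germ (h * g)%g 0 (d + c).
Proof. by move=> hh hg; have := germM hh hg; rewrite addr0 expr0z mul1r. Qed.

Lemma germV0 h c : germ h 0 c -> germ (h^-1)%g 0 (- c).
Proof. by move=> hh; have := germV hh; rewrite oppr0 expr0z mul1r. Qed.

Lemma shiftM h g : shift h -> shift g -> shift (h * g)%g.
Proof. by move=> [c hc] [d gd]; exists (d + c); exact: germM0. Qed.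

Lemma shiftV h : shift h -> shift (h^-1)%g.
Proof. by move=> [c hc]; exists (- c); exact: germV0. Qed.

Lemma shiftJ t g : shift t -> shift (t ^ g)%g.
Proof.
move=> [d td]; have [k [c gc]] := germ_exists g.
by exists (tau ^ (- k) * d); exact: germJ td gc.
Qed.

Lemma shift_exists d : in_Ztau d -> exists t, germ t 0 d.
Proof.
move=> zd; have [n n1] : exists n : nat, 2 - d < n%:R.
  by exists (Num.bound `|2 - d|); rewrite (le_lt_trans (ler_norm _)) // archi_boundP.
have zn : in_Ztau (n%:R + 2 : R).
  have -> : n%:R + 2 = (n%:Z + 2)%:~R :> R by rewrite rmorphD.
  exact: Ztau_int.
have [|||h [_ hE]] := @PL_extend R 1 (n%:R + 2) (n%:R + 2 + d) 0 (Ztau1 R) zn (ZtauD zn zd).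
- by [].
- by have := ler0n R n; lra.
- by lra.
exists h; split=> //; exists (n%:R + 2) => x xn; rewrite hE // expr0z; ring.
Qed.

End Germs.

Section CentralExtension.
Variable R : realType.
Local Notation tau := (tau R).
Implicit Types (h g t s : PL R) (k m n : int).
Local Open Scope group_scope.

Variables (E : groupType) (chi : PL R -> E).
Hypothesis chiM : {morph chi : x y / x * y}.
Hypothesis chi_central : forall h g, compact_supp h -> commute (chi h) (chi g).

Let chi1 : chi 1 = 1.
Proof. by apply: (@mulgI _ (chi 1)); rewrite -chiM !mulg1. Qed.

Let chiV h : chi h^-1 = (chi h)^-1.
Proof. by apply: (@mulgI _ (chi h)); rewrite -chiM !mulgV chi1. Qed.

Let chiJ h g : chi (h ^ g) = chi h ^ chi g.
Proof. by rewrite !conjgE !chiM chiV. Qed.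

Let chiJ_compact h g : compact_supp h -> chi (h ^ g) = chi h.
Proof. by move=> hc; rewrite chiJ; apply/conjg_fixP/commgP/chi_central. Qed.

(** The endomorphism [s^2 + s - 1] of the introduction is [t |-> chi (P t)]
    below.  It is multiplicative on translations at infinity, invariant under
    the homotheties [ga n], and restricts to [chi] on compactly supported
    maps; so [h |-> chi (P (h * ga (- k)))], where [tau ^ k] is the slope of
    [h] at infinity, is multiplicative, and it is trivial on generators. *)
Lemma compact_killed :
  (forall t s, shift t -> shift s -> commute (chi t) (chi s)) ->
  forall h, compact_supp h -> chi h = 1.
Proof.
move=> chi_comm.
have /choice[ga gaE] : forall n : int, exists g : PL R, g =1 kink 1%R n.
  by move=> n; exact: PL_kink (Ztau1 R) ltr01.
have gaD n m : ga (n + m)%R = ga n * ga m.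
  by apply: PL_ext => x; rewrite PLM !gaE -kinkM.
have ga0 : ga 0%R = 1 by apply: PL_ext => x; rewrite gaE kink0.
have gaV n : (ga n)^-1 = ga (- n)%R.
  by apply: (@mulgI _ (ga n)); rewrite mulgV -gaD addrN ga0.
have ga_germ n : germ (ga n) n (1 - tau ^ n)%R.
  split; first by apply: ZtauB; [exact: Ztau1 | exact: Ztau_tauX].
  by exists 1%R => x x1; rewrite gaE kink_ge //; ring.
pose P t := t ^ ga (-2)%R * t ^ ga (-1)%R * t^-1.
have P_compact t : shift t -> compact_supp (P t).
  move=> [d td].
  have := germM0 (germM0 (germJ td (ga_germ (-2)%R)) (germJ td (ga_germ (-1)%R))) (germV0 td).
  rewrite !opprK expr1z (_ : tau ^ 2 = tau * tau)%R // tau_sqr.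
  by rewrite /compact_supp; congr germ; ring.
have PsiM t s : shift t -> shift s -> chi (P (t * s)) = chi (P t) * chi (P s).
  move=> tT sT; rewrite /P !conjMg invMg.
  have cA : commute (chi (s ^ ga (-2)%R)) (chi (t ^ ga (-1)%R)).
    by apply: chi_comm; exact: shiftJ.
  have cB : commute (chi t^-1) (chi (s ^ ga (-2)%R * s ^ ga (-1)%R * s^-1)).
    apply: chi_comm; first exact: shiftV.
    by apply: shiftM; [apply: shiftM; exact: shiftJ | exact: shiftV].
  move: cA cB.
  move: (t ^ ga (-2)%R) (t ^ ga (-1)%R) (s ^ ga (-2)%R) (s ^ ga (-1)%R) (t^-1) (s^-1) =>
    a a' b b' c c'.
  rewrite !chiM => cA cB; rewrite -[RHS]mulgA cB !mulgA; congr (_ * _).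
  by rewrite -[_ * chi a' in LHS]mulgA cA !mulgA.
have Psi_compact h : compact_supp h -> chi (P h) = chi h.
  by move=> hc; rewrite /P 2!chiM !chiJ_compact // chiV mulgK.
have P1 : P 1 = 1 by rewrite /P !conj1g invg1 !mulg1.
have PsiJ t n : shift t -> chi (P (t ^ ga n)) = chi (P t).
  move=> tT; rewrite -(chiJ_compact (ga n) (P_compact _ tT)) /P.
  have JJ m : (t ^ ga n) ^ ga m = (t ^ ga m) ^ ga n by rewrite -!conjgM -!gaD addrC.
  by rewrite !JJ -conjVg -!conjMg.
have PsiV t : shift t -> chi (P t) * chi (P t^-1) = 1.
  by move=> tT; rewrite -PsiM ?mulgV ?P1 //; exact: shiftV.
have Psi_slope h k c : germ h k c -> chi (P (h * ga (- k)%R)) = 1.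
  elim/PL_ind: h k c => [|h g a m IH za a0 gE] k c hk.
    by have [<- _] := germ_uniq (germ1 R) hk; rewrite oppr0 ga0 mulg1 P1.
  have [k' [c' hk']] := germ_exists h.
  (* Kinks of equal slope are conjugate by a translation at infinity. *)
  have [u [uE u1]] : exists u : PL R, shift u /\ g = u * ga m * u^-1.
    have [|e ze /andP[e0 em]] := @Ztau_dense R 0%R (Num.min 1%R a).
      by rewrite lt_min ltr01 a0.
    move: em; rewrite lt_min => /andP[e1 ea].
    have [u [u1 u2]] := @PL_extend R e 1%R a 0%R ze (Ztau1 R) za e0 e1 ea.
    have uR x : (1 <= x)%R -> u x = (a + (x - 1))%R.
      by move=> x1; rewrite u2 // expr0z mul1r.
    exists u; split.
      exists (a - 1)%R; split; first by apply: ZtauB => //; exact: Ztau1.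
      by exists 1%R => x x1; rewrite uR // expr0z; ring.
    apply: (@mulIg _ u); rewrite mulgVK; apply: PL_ext => x; rewrite !PLM gE gaE.
    have ua : u 1%R = a by rewrite uR ?subrr ?addr0.
    case: (leP x 1%R) => x1.
      by rewrite !kink_le // -ua PL_leE.
    rewrite uR ?ltW // kink_ge; last by lra.
    rewrite kink_ge ?ltW // uR; first by ring.
    by rewrite lerDl mulr_ge0 ?ltW ?tauX_gt0 // subr_gt0.
  have g_germ : germ g m (a - tau ^ m * a)%R.
    split; first by apply: ZtauB => //; apply: ZtauM => //; exact: Ztau_tauX.
    by exists a => x x1; rewrite gE kink_ge //; ring.
  have [-> _] := germ_uniq hk (germM hk' g_germ).
  have uV : shift (u^-1 ^ ga (- m)%R) by exact/shiftJ/shiftV.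
  have D : g * ga (- m)%R = u * u^-1 ^ ga (- m)%R.
    by rewrite u1 conjgE gaV opprK !mulgA.
  have -> : h * g * ga (- (k' + m))%R = (h * ga (- k')%R) * (g * ga (- m)%R) ^ ga (- k')%R.
    by rewrite conjgE gaV opprK !mulgA -[h * _ * ga k']mulgA -gaD addNr ga0 mulg1
      -[RHS]mulgA -gaD -opprD [(m + k')%R]addrC.
  have hT : shift (h * ga (- k')%R).
    by have := germM hk' (ga_germ (- k')%R); rewrite addrN => gh;
      exists (tau ^ k' * (1 - tau ^ (- k')) + c')%R.
  have YT : shift (g * ga (- m)%R) by rewrite D; exact: shiftM uE uV.
  rewrite (PsiM _ _ hT (shiftJ _ YT)) (IH _ _ hk') mul1g PsiJ //.
  by rewrite D PsiM // (PsiJ _ _ (shiftV uE)) PsiV.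
move=> h hc; have := Psi_slope h 0%R 0%R hc.
by rewrite oppr0 ga0 mulg1 Psi_compact.
Qed.

Let comm_compact t s : shift t -> shift s -> compact_supp [~ t, s].
Proof.
move=> [c tc] [d sd]; have [_ [zs _]] := (tc, sd).
have := germM0 (germV0 tc) (germM0 (germV0 sd) (germM0 tc sd)).
by rewrite /compact_supp; congr germ; ring.
Qed.

Let B t s := [~ chi t, chi s].

Let BE t s : B t s = chi [~ t, s].
Proof. by rewrite /B !commgEl chiM chiV chiJ. Qed.

Let B_mul t s r : shift t -> shift r -> B (t * s) r = B t r * B s r.
Proof.
move=> tT rT; have -> : B t r = B t r ^ chi s.
  by rewrite BE -chiJ chiJ_compact //; exact: comm_compact.
by rewrite /B chiM !commgEl conjMg invMg conjMg conjgE -conjgE !conjgE !mulgA !mulgK.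
Qed.

Let BV t s : (B t s)^-1 = B s t. Proof. exact: invgR. Qed.

Let B_compact h s : compact_supp h -> B h s = 1.
Proof. by move=> hc; apply/eqP/commgP/chi_central. Qed.

Let B_inv t r : shift t -> shift r -> B t^-1 r = (B t r)^-1.
Proof.
move=> tT rT; apply: (@mulgI _ (B t r)); rewrite -B_mul // !mulgV.
by rewrite B_compact //; exact: germ1.
Qed.

Let shift_ind t1 tt (U : PL R -> Prop) : germ t1 0 1%R -> germ tt 0 tau ->
  (forall t s, shift t -> shift s -> U t -> U s -> U (t * s)) ->
  (forall t, shift t -> U t -> U t^-1) ->
  (forall h, compact_supp h -> U h) -> U t1 -> U tt -> forall t, shift t -> U t.
Proof.
move=> g1 gt UM UV Uc U1 Ut.
have Uint t d : germ t 0 d -> U t -> forall n : int, exists2 s, germ s 0 (n%:~R * d)%R & U s.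
  move=> td Utt n; have tT : shift t by exists d.
  have pos (j : nat) : exists2 s, germ s 0 (j%:~R * d)%R & U s.
    elim: j => [|j [s sd Us]].
      by exists 1; [rewrite mul0r; exact: germ1 | exact/Uc/germ1].
    exists (s * t); last by apply: UM => //; exists (j%:~R * d)%R.
    have := germM0 sd td; congr germ.
    by rewrite -!pmulrn -natr1 mulrDl mul1r addrC.
  case: n => j; first exact: pos.
  have [s sd Us] := pos j.+1; exists s^-1; last by apply: UV => //; exists (j.+1%:~R * d)%R.
  by rewrite NegzE rmorphN mulNr; exact: germV0.
move=> t [d td]; have [[a [b dE]] _] := td.
have [s1 s1d Us1] := Uint _ _ g1 U1 a; have [s2 s2d Us2] := Uint _ _ gt Ut b.
have s12 := germM0 s1d s2d; have rE := germM0 (germV0 s12) td.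
have -> : t = s1 * s2 * ((s1 * s2)^-1 * t) by rewrite mulVKg.
have rc : compact_supp ((s1 * s2)^-1 * t).
  by move: rE; rewrite /compact_supp; congr germ; rewrite dE; ring.
apply: (UM _ _); [by eexists; exact: s12|exact: compact_shift| |exact: Uc].
by apply: (UM _ _) => //; eexists; [exact: s1d | exact: s2d].
Qed.

(** The commutators of translations at infinity are bilinear in the translation
    lengths, so they are powers of [c], the one for the lengths 1 and [tau].
    A homothety turns these lengths into [tau] and [1 - tau], so [c] is also
    the commutator for [tau] and 1, which is [c^-1]. *)
Lemma shift_commutators : exists2 c, compact_supp c &
  chi c * chi c = 1 /\ forall t s, shift t -> shift s ->
    [~ chi t, chi s] = 1 \/ [~ chi t, chi s] = chi c.
Proof.
have [t1 g1] := shift_exists (Ztau1 R); have [tt gt] := shift_exists (Ztau_tau R).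
have t1T : shift t1 by exists 1%R.
have ttT : shift tt by exists tau.
exists [~ t1, tt]; first exact: comm_compact.
rewrite -BE; set c := B t1 tt.
have cc : c * c = 1.
  have [g gE] := PL_kink (-1)%R (Ztau1 R) ltr01.
  have gg : germ g (-1)%R (1 - tau ^ (-1))%R.
    split; first by apply: ZtauB; [exact: Ztau1 | exact: Ztau_tauX].
    by exists 1%R => x x1; rewrite gE kink_ge //; ring.
  have t1g : germ (t1 ^ g) 0 tau by have := germJ g1 gg; rewrite opprK expr1z mulr1.
  have ttg : germ (tt ^ g) 0 (1 - tau)%R.
    by have := germJ gt gg; rewrite opprK expr1z tau_sqr.
  have [h hc E1] : exists2 h, compact_supp h & t1 ^ g = tt * h.
    exists (tt^-1 * t1 ^ g); last by rewrite mulVKg.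
    by have := germM0 (germV0 gt) t1g; rewrite /compact_supp; congr germ; ring.
  have [h' hc' E2] : exists2 h, compact_supp h & tt ^ g = t1 * (tt^-1 * h).
    exists (tt * (t1^-1 * tt ^ g)); last by rewrite mulKg mulVKg.
    by have := germM0 gt (germM0 (germV0 g1) ttg); rewrite /compact_supp; congr germ; ring.
  have h'T := compact_shift hc'; have hT := compact_shift hc.
  have ttV := shiftV ttT; have rT := shiftM ttV h'T; have sT := shiftM t1T rT.
  have Ec : c = B (t1 ^ g) (tt ^ g).
    by rewrite /c BE -(chiJ_compact g (comm_compact t1T ttT)) conjRg -BE.
  have Ec' : B (t1 ^ g) (tt ^ g) = c^-1.
    rewrite E1 E2 B_mul // (B_compact _ hc) mulg1 -BV B_mul // B_mul // B_inv //.
    rewrite (B_compact _ hc') mulg1 /B commgg invg1 mulg1 //.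
  by rewrite {1}Ec Ec' mulVg.
split=> //.
have cV : c^-1 = c by apply: (@mulgI _ c); rewrite mulgV.
pose D (x : E) := x = 1 \/ x = c.
have DM x y : D x -> D y -> D (x * y).
  by move=> [->|->] [->|->]; rewrite ?mulg1 ?mul1g ?cc; [left|right|right|left].
have DV x : D x -> D x^-1 by move=> [->|->]; rewrite ?invg1 ?cV; [left|right].
have Dsym t s : D (B t s) -> D (B s t) by move=> /DV; rewrite BV.
have step s : shift s -> D (B t1 s) -> D (B tt s) -> forall t, shift t -> D (B t s).
  move=> sT; apply: (shift_ind (U := fun t => D (B t s)) g1 gt) => [t r tT rT ? ?|t tT ?|h hc].
  - by rewrite B_mul //; exact: DM.
  - by rewrite B_inv //; exact: DV.
  - by rewrite B_compact //; left.
move=> t s tT sT; apply: (step s sT) => //; apply: (Dsym _ _); apply: (step _ _) => //.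
- by left; rewrite /B commgg.
- by apply: (Dsym _ _); right.
- by right.
- by left; rewrite /B commgg.
Qed.

End CentralExtension.

Section IndexTwo.
Variable R : realType.
Implicit Types (h g : PL R).
Local Open Scope group_scope.

(** [shift_commutators] is applied to the quotient by [Z], then
    [compact_killed] to the quotient by [Z] and [c]. *)
Lemma compact_mod_two (Z : {pred PL R}) :
  group_closed Z -> (forall g h, h \in Z -> h ^ g \in Z) ->
  (forall h g, compact_supp h -> [~ h, g] \in Z) ->
  exists c, [/\ compact_supp c, c * c \in Z &
    forall h, compact_supp h -> h \in Z \/ c^-1 * h \in Z].
Proof.
move=> Zg ZJ Zc; have [E [chi [chiM chiZ]]] := quotient_group_exists Zg ZJ.
have chi1 : chi 1 = 1 by apply/chiZ; exact: Zg.1.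
have chiV h : chi h^-1 = (chi h)^-1.
  by apply: (@mulgI _ (chi h)); rewrite -chiM !mulgV.
have chiJ h g : chi (h ^ g) = chi h ^ chi g by rewrite !conjgE !chiM chiV.
have chi_central h g : compact_supp h -> commute (chi h) (chi g).
  move=> hc; apply/commgP/eqP; rewrite commgEl -chiJ -chiV -chiM; apply/chiZ.
  exact: Zc.
have [c cc [c2 cT]] := shift_commutators chiM chi_central.
have cV : (chi c)^-1 = chi c by apply: (@mulgI _ (chi c)); rewrite mulgV.
have eqc h : chi h = chi c <-> c^-1 * h \in Z.
  rewrite -chiZ chiM chiV; split=> [->|e]; first by rewrite mulVg.
  by apply: (@mulgI _ (chi c)^-1); rewrite e mulVg.
exists c; split=> //; first by apply/chiZ; rewrite chiM.
pose Z' : {pred PL R} := [pred h | (h \in Z) || (c^-1 * h \in Z)].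
have Z'P h : h \in Z' <-> chi h = 1 \/ chi h = chi c.
  by rewrite eqc chiZ; split=> [/orP|[?|?]]; rewrite ?inE //; apply/orP; [left|right].
have Z'g : group_closed Z'.
  split; first by apply/Z'P; left.
  move=> x y /Z'P xZ /Z'P yZ; apply/Z'P; rewrite chiM chiV.
  by case: xZ => ->; case: yZ => ->; rewrite ?invg1 ?cV ?mulg1 ?mul1g ?c2; [left|right|right|left].
have Z'J x y : y \in Z' -> y ^ x \in Z'.
  move=> /Z'P yZ; apply/Z'P; rewrite chiJ; case: yZ => ->; rewrite ?conj1g; first by left.
  by right; apply/conjg_fixP/commgP/chi_central.
have [E' [chi' [chi'M chi'Z]]] := quotient_group_exists Z'g Z'J.
have chi'1 : chi' 1 = 1 by apply/chi'Z; exact: Z'g.1.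
have chi'V h : chi' h^-1 = (chi' h)^-1.
  by apply: (@mulgI _ (chi' h)); rewrite -chi'M !mulgV.
have chi'R h g : chi' [~ h, g] = [~ chi' h, chi' g].
  by rewrite !commgEl !conjgE !chi'M !chi'V.
have chiR h g : chi [~ h, g] = [~ chi h, chi g].
  by rewrite !commgEl !conjgE !chiM !chiV.
move=> h hc; apply/orP.
suff /chi'Z : chi' h = 1 by [].
apply: (compact_killed chi'M) hc => [x y xc|t s tT sT].
  apply/commgP/eqP; rewrite -chi'R; apply/chi'Z/Z'P; left; apply/chiZ; exact: Zc.
apply/commgP/eqP; rewrite -chi'R; apply/chi'Z/Z'P; rewrite chiR; exact: cT.
Qed.

End IndexTwo.

(** * Elements of the circle group *)

Section Circle.
Variable R : realType.
Local Notation I := (unitI R).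
Implicit Types (x y z a b : I).

Definition pt (x : R) (h : 0 < x <= 1) : I := exist _ x h.

Lemma ptE (x : R) (h : 0 < x <= 1) : val (pt h) = x. Proof. by []. Qed.

Lemma I_gt0 x : 0 < val x. Proof. by case/andP: (valP x). Qed.
Lemma I_le1 x : val x <= 1. Proof. by case/andP: (valP x). Qed.

Lemma cyc_neq x y z : cyc x y z -> [/\ x != y, y != z & x != z].
Proof.
rewrite /cyc -!(inj_eq val_inj) => /or3P[] /andP[h1 h2];
  by split; rewrite ?(lt_eqF h1) ?(lt_eqF h2) ?(gt_eqF h1) ?(gt_eqF h2)
    ?(lt_eqF (lt_trans h1 h2)) ?(gt_eqF (lt_trans h1 h2)).
Qed.

Lemma cyc_total x y z : x != y -> y != z -> x != z -> cyc x y z \/ cyc x z y.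
Proof.
rewrite /cyc -!(inj_eq val_inj).
move: (val x) (val y) (val z) => a b c.
by case: (ltgtP a b) => //; case: (ltgtP b c) => //; case: (ltgtP a c) => //;
   by [left | right].
Qed.

Lemma cyc_asym x y z : cyc x y z -> ~ cyc x z y.
Proof.
by rewrite /cyc => /or3P[] /andP[h1 h2] /or3P[] /andP[h3 h4]; lra.
Qed.

Lemma cyc_can (f g : I -> I) : cancel f g -> cancel g f ->
  circle_orientation_preserving f -> circle_orientation_preserving g.
Proof.
move=> fK gK fc x y z xyz; have [n1 n2 n3] := cyc_neq xyz.
have gn a b : a != b -> g a != g b by rewrite (inj_eq (can_inj gK)).
case: (cyc_total (gn _ _ n1) (gn _ _ n2) (gn _ _ n3)) => // /fc.
by rewrite !gK => /(cyc_asym xyz).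
Qed.

(** The quotient topology of the circle is that of its cyclic order, so that
    continuity is automatic for the bijections preserving this order. *)
Lemma circle_openP (U : set I) : circle_open U <->
  forall x, U x -> exists a b, cyc a x b /\ forall z, cyc a z b -> U z.
Proof.
split=> [[W [Wo OU O0]] x Ux|arc].
  have nearO (y : R) : W y -> exists2 e : R, 0 < e & forall t : R, `|y - t| < e -> W t.
    move=> Wy; have /nbhs_ballP[e /= e0 eP] : nbhs y W by apply: open_nbhs_nbhs.
    by exists e => // t yt; apply: eP.
  have x0 := I_gt0 x.
  have [x1|x1] := ltP (val x) 1.
    have [e e0 eP] := nearO _ ((OU x).2 Ux).
    pose a := Num.max (val x / 2) (val x - e / 2).
    pose b := Num.min ((val x + 1) / 2) (val x + e / 2).
    have [a1 a2 a3] : [/\ val x / 2 <= a, val x - e / 2 <= a & a < val x].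
      by rewrite /a !le_max !lexx orbT gt_max; split=> //; apply/andP; split; lra.
    have [b1 b2 b3] : [/\ b <= (val x + 1) / 2, b <= val x + e / 2 & val x < b].
      by rewrite /b !ge_min !lexx orbT lt_min; split=> //; apply/andP; split; lra.
    have ha : 0 < a <= 1 by apply/andP; split; lra.
    have hb : 0 < b <= 1 by apply/andP; split; lra.
    exists (pt ha), (pt hb); split=> [|z]; rewrite /cyc !ptE ?a3 ?b3 // => zP.
    by apply/OU/eP; rewrite ltr_norml; case/or3P: zP => /andP[h1 h2]; between.
  have {}x1 : val x = 1 by apply: le_anti; rewrite I_le1.
  have [e e0 eP] := nearO _ ((OU x).2 Ux); have [d d0 dP] := nearO _ ((O0 x x1).2 Ux).
  pose a := Num.max (2 / 3 : R) (1 - e / 2); pose b := Num.min (1 / 3 : R) (d / 2).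
  have [a1 a2 a3] : [/\ 2 / 3 <= a, 1 - e / 2 <= a & a < 1].
    by rewrite /a !le_max !lexx orbT gt_max; split=> //; apply/andP; split; lra.
  have [b1 b2 b3] : [/\ b <= 1 / 3, b <= d / 2 & 0 < b].
    by rewrite /b !ge_min !lexx orbT lt_min; split=> //; apply/andP; split; lra.
  have ha : 0 < a <= 1 by apply/andP; split; lra.
  have hb : 0 < b <= 1 by apply/andP; split; lra.
  exists (pt ha), (pt hb); split=> [|z]; rewrite /cyc !ptE.
    by apply/or3P; constructor 3; apply/andP; split; rewrite ?x1 //; lra.
  have := I_le1 z; have := I_gt0 z => z0 z1 /or3P[] /andP[h1 h2].
  - by lra.
  - by apply/OU/dP; rewrite ltr_norml; between.
  - by apply/OU/eP; rewrite ltr_norml; between.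
(* The condition on [`|y|] puts 0 in [O] exactly when the base point is in
   [U]. *)
pose O (y : R) := exists e : R, [/\ 0 < e, forall z, `|val z - y| < e -> U z &
  `|y| < e -> forall x, val x = 1 -> U x].
exists O; split.
- rewrite openE => y [e [e0 e1 e2]]; apply/nbhs_ballP; exists (e / 2) => /=; first by lra.
  move=> y' /=; rewrite /ball /= => yy'; exists (e / 2); split; first by lra.
    move=> z zy'; apply: e1; apply: le_lt_trans (ler_distD y' _ _) _.
    by rewrite [`|y' - y|]distrC; lra.
  move=> y'0 x; apply: e2; have := ler_distD y' y 0; rewrite !subr0; lra.
- move=> x; split=> [[e [e0 e1 _]]|]; first by apply: e1; rewrite subrr normr0.
  move=> /arc[a [b [axb abU]]]; have a0 := I_gt0 a; have x0 := I_gt0 x.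
  have [e [e0 eP ex]] : exists e : R, [/\ 0 < e, forall z, `|val z - val x| < e -> cyc a z b &
      e <= val x].
    case/or3P: axb => /andP[h1 h2].
    + exists (Num.min (val x - val a) (val b - val x)); split.
      * by rewrite lt_min !subr_gt0 h1.
      * by move=> z; rewrite lt_min !ltr_norml => /andP[/andP[? ?] /andP[? ?]];
          apply/or3P; constructor 1; apply/andP; split; lra.
      * by rewrite ge_min; apply/orP; left; lra.
    + exists (Num.min (val x) (val b - val x)); split.
      * by rewrite lt_min !subr_gt0 h1 x0.
      * by move=> z; rewrite lt_min !ltr_norml => /andP[/andP[? ?] /andP[? ?]];
          apply/or3P; constructor 2; apply/andP; split; lra.
      * by rewrite ge_min lexx.
    + exists (val x - val a); split; [by rewrite subr_gt0| |by lra].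
      by move=> z; rewrite ltr_norml => /andP[? ?]; apply/or3P; constructor 3; between.
  exists e; split=> // [z /eP/abU //|]; rewrite gtr0_norm //; lra.
- move=> x x1; split=> [[e [e0 _ e2]]|]; first by apply: e2; rewrite ?normr0.
  move=> Ux; have [a [b [axb abU]]] := arc _ Ux.
  have a1 := I_le1 a; have b1 := I_le1 b; have b0 := I_gt0 b.
  have ba : val b < val a by move: axb; rewrite /cyc x1 => /or3P[] /andP[? ?]; lra.
  exists (val b); split=> // [z|_ y y1].
    rewrite subr0 gtr0_norm ?I_gt0 // => zb.
    by apply: abU; apply/or3P; constructor 2; rewrite zb.
  by have -> : y = x by apply: val_inj; rewrite y1.
Qed.

Lemma cyc_homeo (f : I -> I) : bijective f -> circle_orientation_preserving f ->
  circle_homeo f.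
Proof.
have pre (f' g' : I -> I) : cancel f' g' -> cancel g' f' ->
    circle_orientation_preserving f' -> forall U, circle_open U -> circle_open (f' @^-1` U).
  move=> fK gK fc U /circle_openP oU; apply/circle_openP => x /oU[a [b [axb abU]]].
  exists (g' a), (g' b); split; first by rewrite -(fK x); exact: (cyc_can fK gK fc).
  by move=> z /fc; rewrite !gK; exact: abU.
move=> [g fK gK] fc; split; [by exists g | exact: pre fK gK fc |].
move=> U oU; have -> : f @` U = g @^-1` U.
  apply/seteqP; split=> [_ [x Ux <-]|x Ugx] /=; first by rewrite fK.
  by exists (g x).
exact: pre gK fK (cyc_can fK gK fc) _ oU.
Qed.

End Circle.

Section Embedding.
Variable R : realType.
Local Notation tau := (tau R).
Local Notation I := (unitI R).
Implicit Types (f g : Ttau R) (h : PL R).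

(** How elements of [PL R] act on the circle; they do so as soon as they fix 1
    ([agree_exists]). *)
Definition agree h f := forall x : I, val (f x) = h (val x).

(** With triviality near 0, which all elements of [PL R] share, this gives
    triviality near the base point of the circle. *)
Definition local h := exists2 b : R, b < 1 & forall x, b <= x -> h x = x.

Lemma TtauK f : cancel f (f^-1)%g.
Proof. by move=> x; rewrite -TtauM mulVg. Qed.
Lemma TtauVK f : cancel (f^-1)%g f.
Proof. by move=> x; rewrite -TtauM mulgV. Qed.
Lemma TtauJ f g x : (f ^ g)%g x = (g^-1)%g (f (g x)).
Proof. by []. Qed.
Lemma Ttau1 x : (1%g : Ttau R) x = x. Proof. by []. Qed.
Lemma Ttau_cyc f : circle_orientation_preserving f.
Proof. by have [] := Ttau_in f. Qed.

Lemma Ttau_make (F : I -> I) : in_Vtau F -> circle_orientation_preserving F ->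
  exists f : Ttau R, f =1 F.
Proof.
move=> FV Fc; have FT : in_Ttau F by split=> //; apply: cyc_homeo => //; exact: FV.1.
by exists (MkTtau (asboolT FT)).
Qed.

Lemma agree_exists h : h 1 = 1 -> exists f, agree h f.
Proof.
have itv h' (h1 : h' 1 = 1) (x : I) : 0 < h' (val x) <= 1.
  by have := PL_leE h' (val x) 1; rewrite h1 PL_gt0 => ->; exact: (valP x).
move=> h1; have h1' : (h^-1)%g 1 = 1 by rewrite -{1}h1 PLK.
pose F (x : I) := pt (itv h h1 x); pose G (x : I) := pt (itv _ h1' x).
have [||f fE] := @Ttau_make F; last by exists f => x; rewrite fE ptE.
  split; first by exists G => x; apply: val_inj; rewrite /= ?PLK ?PLVK.
  have [s zs sP] := PL_pieces h; exists s; split=> // u v u0 uv v1 av.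
  by have [k [c hE]] := sP u v uv av; exists k, c => x xuv; exact: hE.
by move=> x y z; rewrite /cyc !ptE !PL_ltE.
Qed.

Lemma local_fix1 h : local h -> h 1 = 1.
Proof. by move=> [b b1 ->] //; exact: ltW. Qed.

Lemma agreeM h h' f f' : agree h f -> agree h' f' -> agree (h * h')%g (f * f')%g.
Proof. by move=> hf hf' x; rewrite TtauM hf hf'. Qed.

Lemma agreeV h f : agree h f -> agree (h^-1)%g (f^-1)%g.
Proof. by move=> hf x; apply: (can_inj (PLK h)); rewrite PLVK -hf TtauVK. Qed.

Lemma agreeJ h h' f f' : agree h f -> agree h' f' -> agree (h ^ h')%g (f ^ f')%g.
Proof. by move=> hf hf'; apply: agreeM (agreeV hf') (agreeM hf hf'). Qed.

Lemma localM h h' : local h -> local h' -> local (h * h')%g.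
Proof.
move=> [b b1 hP] [b' b'1 h'P]; exists (Num.max b b'); first by rewrite gt_max b1.
by move=> x; rewrite ge_max PLM => /andP[h1 h2]; rewrite h'P ?hP.
Qed.

Lemma localV h : local h -> local (h^-1)%g.
Proof.
by move=> [b b1 hP]; exists b => // x bx; apply: (can_inj (PLK h)); rewrite PLVK hP.
Qed.

(** The rotation by [tau] moves the base point inside the interval, so its
    conjugates of local elements reach the neighbourhood of the base point. *)
Lemma rotation_exists : exists r : Ttau R, forall x : I,
  val (r x) = if val x <= 1 - tau then val x + tau else val x + tau - 1.
Proof.
have t0 := tau_gt0 R; have t1 := tau_lt1 R.
have itv (x : I) : 0 < (if val x <= 1 - tau then val x + tau else val x + tau - 1) <= 1.
  by have := I_gt0 x; have := I_le1 x; case: ifPn; rewrite -?ltNge => *; between.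
have itv' (x : I) : 0 < (if val x <= tau then val x + 1 - tau else val x - tau) <= 1.
  by have := I_gt0 x; have := I_le1 x; case: ifPn; rewrite -?ltNge => *; between.
pose F x := pt (itv x); pose G x := pt (itv' x).
have FK : cancel F G.
  move=> x; apply: val_inj; rewrite !ptE; have := I_gt0 x; have := I_le1 x.
  by do 2?[case: ifPn; rewrite -?ltNge] => *; lra.
have GK : cancel G F.
  move=> x; apply: val_inj; rewrite !ptE; have := I_gt0 x; have := I_le1 x.
  by do 2?[case: ifPn; rewrite -?ltNge] => *; lra.
have [||f fE] := @Ttau_make F; last by exists f => x; rewrite fE ptE.
  split; first by exists G.
  exists [:: 1 - tau]; split=> [b|u v u0 uv v1 av].
    by rewrite inE => /eqP->; apply: ZtauB; [exact: Ztau1 | exact: Ztau_tau].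
  have := av _ (mem_head _ _); rewrite negb_and -!leNgt => /orP[h|h].
    exists 0, (tau - 1) => x /andP[h1 h2]; rewrite ptE expr0z mul1r.
    by rewrite leNgt (le_lt_trans h h1) /= addrA.
  exists 0, tau => x /andP[h1 h2]; rewrite ptE expr0z mul1r.
  by rewrite (le_trans h2 h).
have cyc_r (x y z : I) : cyc x y z -> cyc y z x.
  by rewrite /cyc => /or3P[] ->; rewrite ?orbT.
suff Fc (x y z : I) : val x < val y -> val y < val z -> cyc (F x) (F y) (F z).
  move=> x y z /or3P[] /andP[h1 h2]; first exact: Fc.
    exact: (cyc_r (F z) (F x) (F y) (cyc_r (F y) (F z) (F x) (Fc _ _ _ h1 h2))).
  exact: (cyc_r (F z) (F x) (F y) (Fc _ _ _ h1 h2)).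
have x0 := I_gt0 x; have z1 := I_le1 z; move=> xy yz; rewrite /cyc !ptE.
move: (val x) (val y) (val z) x0 z1 xy yz => a b c a0 c1 ab bc {F G FK GK itv itv' cyc_r}.
case: (leP c (1 - tau)) => hc.
  have hb : b <= 1 - tau by lra.
  have ha : a <= 1 - tau by lra.
  by rewrite ha hb; apply/or3P; constructor 1; between.
case: (leP b (1 - tau)) => hb.
  have ha : a <= 1 - tau by lra.
  by rewrite ha; apply/or3P; constructor 3; between.
case: (leP a (1 - tau)) => ha; apply/or3P; first by constructor 2; between.
by constructor 1; between.
Qed.

End Embedding.

(** * Local generation of the circle group *)

Section NextPoint.
Variable R : realType.

Lemma next_point (s : seq R) (v e : R) : v < e ->
  exists p, [/\ v < p, p <= e, p = e \/ p \in s & {in s, forall b, ~~ (v < b < p)}].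
Proof.
move=> ve; elim: s => [|c s [p [vp pe ps av]]]; first by exists e; split=> //; left.
case: (boolP (v < c < p)) => [/andP[vc cp]|nc].
  exists c; split=> //; [exact: ltW (lt_le_trans cp pe)|by right; rewrite mem_head|].
  move=> b; rewrite inE => /orP[/eqP->|/av]; first by rewrite ltxx andbF.
  by apply: contra => /andP[-> bc]; exact: lt_trans bc cp.
exists p; split=> //.
  by case: ps => [|ps]; [left | right; rewrite inE ps orbT].
by move=> b; rewrite inE => /orP[/eqP->|/av].
Qed.

Lemma prev_point (s : seq R) (e v : R) : e < v ->
  exists p, [/\ e <= p, p < v & {in s, forall b, ~~ (p < b < v)}].
Proof.
move=> ev; elim: s => [|c s [p [ep pv av]]]; first by exists e.
case: (boolP (p < c < v)) => [/andP[pc cv]|nc].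
  exists c; split=> //; first exact: ltW (le_lt_trans ep pc).
  move=> b; rewrite inE => /orP[/eqP->|/av]; first by rewrite ltxx.
  by apply: contra => /andP[cb ->]; rewrite (lt_trans pc cb).
exists p; split=> //.
by move=> b; rewrite inE => /orP[/eqP->|/av].
Qed.

Lemma count_lt (a1 a2 : pred R) (s : seq R) (x : R) : subpred a1 a2 ->
  x \in s -> a2 x -> ~~ a1 x -> (count a1 s < count a2 s)%N.
Proof.
move=> sub xs x2 x1; have xs2 : x \in seq.filter a2 s by rewrite mem_filter x2.
have -> : count a1 s = count a1 (seq.filter a2 s).
  rewrite count_filter; apply: eq_count => y /=.
  by case: (boolP (a1 y)) => // /sub ->.
rewrite -!size_filter -[ltnRHS](count_predC a1) size_filter -[ltnLHS]addn0 ltn_add2l.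
by rewrite -has_count; apply/hasP; exists x.
Qed.

End NextPoint.

Section Monotone.
Variable R : realType.
Local Notation tau := (tau R).
Local Notation I := (unitI R).
Implicit Types (f g : Ttau R) (h : PL R) (x y z : I).

Definition itop : I := pt (introT andP (conj ltr01 (lexx (1 : R)))).

Lemma itopE x : val x = 1 -> x = itop.
Proof. by move=> x1; apply: val_inj. Qed.

Lemma fix1_mono f x y : f itop = itop -> val x < val y -> val (f x) < val (f y).
Proof.
move=> f1 xy; have x0 := I_gt0 x; have y1 := I_le1 y.
have x1 : val x < 1 by exact: lt_le_trans xy y1.
have inj := can_inj (TtauK f).
have fx1 : val (f x) < 1.
  rewrite lt_neqAle I_le1 andbT; apply/eqP => /itopE; rewrite -f1 => /inj xt.
  by rewrite xt ltxx in x1.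
have [y1'|y1'] := ltP (val y) 1; last first.
  by rewrite (itopE (le_anti (introT andP (conj y1 y1')))) f1.
have : cyc x y itop by apply/or3P; constructor 1; rewrite xy.
move=> /(@Ttau_cyc _ f); rewrite f1 /cyc ptE.
move: (val (f x)) (val (f y)) (I_le1 (f y)) fx1 => a b b1 a1.
by move=> /or3P[] /andP[]; lra.
Qed.

(** A monotone bijection has no jumps, so the affine formula valid to the right
    of [p] has the limit [l] at [p].  Here [l] stands for [f p], or for 0 when
    [p = 0], where [f] is not defined. *)
Lemma fix1_right_limit f (p p' k c l : R) : f itop = itop ->
  0 <= p -> p < p' -> p' <= 1 -> 0 < k -> 0 <= l ->
  (forall x, p < val x <= p' -> val (f x) = k * val x + c) ->
  (forall x, val x <= p -> val (f x) <= l) -> (forall x, p < val x -> l < val (f x)) ->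
  k * p + c = l.
Proof.
move=> f1 p0 pp' p'1 k0 l0 fE fle fgt.
have ex (t : R) : p < t <= p' -> exists2 x : I, val x = t & val (f x) = k * t + c.
  move=> /andP[lpt tp]; have t1 : 0 < t <= 1 by between.
  by exists (pt t1) => //; rewrite fE ?ptE //; apply/andP.
apply: le_anti; apply/andP; split; rewrite leNgt; apply/negP => lt.
  pose y := (l + (k * p + c)) / 2.
  have [x xE fx] := ex p' (introT andP (conj pp' (lexx p'))).
  have kp : k * p < k * p' by rewrite ltr_pM2l.
  have f1' := I_le1 (f x).
  have y01 : 0 < y <= 1 by rewrite /y; between.
  have := TtauVK f (pt y01); set z := (f^-1)%g _ => /(congr1 val); rewrite ptE => fz.
  case: (leP (val z) p) => zp; first by have := fle _ zp; rewrite fz /y; lra.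
  case: (leP (val z) p') => zp'.
    have := fE z; rewrite zp zp' fz => /(_ isT).
    have : k * p < k * val z by rewrite ltr_pM2l.
    by rewrite /y; lra.
  have := fix1_mono f1 (_ : val x < val z); rewrite xE => /(_ zp').
  by rewrite fx fz /y; lra.
pose d := Num.min (p' - p) ((l - (k * p + c)) / k).
have d0 : 0 < d by rewrite lt_min subr_gt0 pp' divr_gt0 // subr_gt0.
have d1 : d <= p' - p by rewrite ge_min lexx.
have d2 : k * d <= l - (k * p + c).
  by rewrite mulrC -ler_pdivlMr // ge_min lexx orbT.
have [|x xE fx] := ex (p + d); first by between.
have := fgt x; rewrite xE fx ltrDl => /(_ d0); rewrite mulrDr; lra.
Qed.

(** The element of [PL R] is built by correcting the slope with a kink at each
    breakpoint in turn; the induction is on the number of breakpoints to the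
    right of [v]. *)
Lemma fix1_PL f h v : f itop = itop -> in_Ztau v -> 0 < v ->
  (forall x, val x = v -> val (f x) = h v) ->
  exists g : PL R, (forall t, t <= v -> g t = h t) /\
    (forall x, v <= val x -> val (f x) = g (val x)).
Proof.
move=> f1; have [[_ [s [zs sP]]] _ _] := Ttau_in f.
have [n] := ubnP (count (fun b => v < b) s).
elim: n v h => // n IH v h; rewrite ltnS => cn zv v0 fv.
have [v1|v1] := leP 1 v.
  exists h; split=> // x vx; have := I_le1 x => x1.
  have xv : val x = v by lra.
  by rewrite (fv _ xv) xv.
have [p [vp p1 ps av]] := next_point s v1.
have [k [c fE]] := sP v p (ltW v0) vp p1 av.
have v01 : 0 < v <= 1 by between.
pose xv := pt v01.
have flim : tau ^ k * v + c = h v.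
  rewrite -(fv xv) //; apply: (fix1_right_limit f1 (ltW v0) vp p1 (tauX_gt0 R k) _ fE).
  - exact/ltW/I_gt0.
  - move=> x; rewrite le_eqVlt => /orP[/eqP E|xv']; last exact/ltW/fix1_mono.
    by have -> : x = xv by apply: val_inj.
  - by move=> x vx; apply: fix1_mono.
have [_ [h1 [m [h1l h1r]]]] := PL_straighten h zv v0.
have [e eE] := PL_kink (k - m) zv v0.
have gl t : t <= v -> (h1 * e)%g t = h t.
  by move=> tv; rewrite PLM eE kink_le // h1l.
have gr x : v <= val x -> val x <= p -> val (f x) = (h1 * e)%g (val x).
  rewrite le_eqVlt => /orP[/eqP E|vx] xp; first by rewrite -E gl // fv.
  rewrite fE ?vx // PLM eE kink_ge ?ltW // h1r; last first.
    by rewrite lerDl mulr_ge0 ?ltW ?tauX_gt0 // subr_gt0.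
  have E : tau ^ k = tau ^ m * tau ^ (k - m) by rewrite -tauXD addrC subrK.
  by rewrite -flim E; ring.
case: ps => [pE|ps].
  exists (h1 * e)%g; split=> // x vx; apply: gr => //; rewrite pE; exact: I_le1.
have [||||g [g1 g2]] := IH p (h1 * e)%g.
- apply: leq_trans cn; apply: (count_lt _ ps) => //; last by rewrite ltxx.
  by move=> b; apply: lt_trans.
- exact: zs.
- exact: lt_trans v0 vp.
- by move=> x xp; rewrite gr ?xp // ltW.
exists g; split=> [t tv|x vx]; first by rewrite g1 ?gl //; lra.
by case: (leP (val x) p) => xp; [rewrite g1 ?gr | rewrite g2 // ltW].
Qed.

Lemma fix1_germ0 f e : f itop = itop -> 0 < e <= 1 -> exists v k,
  [/\ 0 < v, v <= e & forall x, val x <= v -> val (f x) = tau ^ k * val x].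
Proof.
move=> f1 /andP[e0 e1]; have [[_ [s [zs sP]]] _ _] := Ttau_in f.
have [v [v0 ve _ av]] := next_point s e0.
have [k [c fE]] := sP 0 v (lexx 0) v0 (le_trans ve e1) av.
have c0 : tau ^ k * 0 + c = 0.
  apply: (fix1_right_limit f1 (lexx 0) v0 (le_trans ve e1) (tauX_gt0 R k) (lexx 0) fE).
    by move=> x; rewrite leNgt I_gt0.
  by move=> x _; exact: I_gt0.
exists v, k; split=> // x xv; rewrite fE ?I_gt0 //.
by move: c0; rewrite mulr0 add0r => ->; rewrite addr0.
Qed.

Lemma fix1_near1_local f (v w : R) : f itop = itop -> 0 < v -> w < 1 ->
  (forall x, val x <= v -> f x = x) -> (forall x, w <= val x -> f x = x) ->
  exists2 h, local h & agree h f.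
Proof.
move=> f1 v0 w1 fv fw.
have [|u zu /andP[u0]] := @Ztau_dense R 0 (Num.min v 1); first by rewrite lt_min v0 ltr01.
rewrite lt_min => /andP[uv u1].
have [|b zb /andP[]] := @Ztau_dense R (Num.max u w) 1; first by rewrite gt_max u1.
rewrite gt_max => /andP[ub wb] b1.
have [x xu|g [g1 g2]] := @fix1_PL f 1%g u f1 zu u0.
  by rewrite fv ?xu ?ltW.
have b0 : 0 < b by lra.
have b01 : 0 < b <= 1 by between.
have gb : g b = b by have := g2 (pt b01); rewrite fw ptE ?ltW // => <-.
have [_ [g' [k [g'1 g'2]]]] := PL_straighten g zb b0.
have [e eE] := PL_kink (- k) zb b0.
have he t : b <= t -> (g' * e)%g t = t.
  move=> bt; rewrite PLM eE kink_ge // g'2.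
    by rewrite gb [b + _ - b]addrAC subrr add0r tauXVK; ring.
  by rewrite lerDl mulr_ge0 ?subr_ge0 // ltW ?tauX_gt0.
exists (g' * e)%g; first by exists b.
move=> x; case: (leP b (val x)) => bx; first by rewrite he // fw //; lra.
rewrite PLM eE kink_le ?ltW // g'1 ?ltW //.
case: (leP (val x) u) => xu; first by rewrite g1 ?fv //; lra.
by rewrite g2 // ltW.
Qed.

(** The values near 1 and near 0 meet at the preimage of the base point, where
    the map therefore jumps: it is 1 or one of the breakpoints. *)
Lemma Ttau_top_preimage f x : f x = itop -> in_Ztau (val x).
Proof.
move=> fx; have [[_ [s [zs sP]]] _ _] := Ttau_in f.
have [x1|x1] := leP 1 (val x).
  have -> : val x = 1 by apply: le_anti; rewrite I_le1.
  exact: Ztau1.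
case: (boolP (val x \in s)) => [/zs //|xs]; exfalso.
have [v [xv v1 _ avr]] := next_point s x1.
have [u [u0 ux avl]] := prev_point s (I_gt0 x).
have [b bs|k [c fE]] := sP u v u0 (lt_trans ux xv) v1.
  apply/negP => /andP[ub bv]; case: (ltgtP b (val x)) => bx.
  - by have := avl _ bs; rewrite ub bx.
  - by have := avr _ bs; rewrite bv bx.
  - by move: xs; rewrite -bx bs.
have v01 : 0 < v <= 1 by have := I_gt0 x; move=> x0; between.
have := fE x; rewrite ux ltW // fx ptE => /(_ isT) E1.
have := fE (pt v01); rewrite ptE lexx (lt_trans ux xv) => /(_ isT) E2.
have := I_le1 (f (pt v01)); rewrite E2 {1}E1.
have : tau ^ k * val x < tau ^ k * v by rewrite ltr_pM2l ?tauX_gt0.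
lra.
Qed.

Lemma Ttau_top f : in_Ztau (val (f itop)).
Proof. by apply: (@Ttau_top_preimage (f^-1)%g); rewrite TtauK. Qed.

Lemma local_move (a b : R) : in_Ztau a -> in_Ztau b -> 0 < a < 1 -> 0 < b < 1 ->
  exists2 h, local h & h a = b.
Proof.
move=> za zb /andP[a0 a1] /andP[b0 b1].
have [|e ze /andP[e0]] := @Ztau_dense R 0 (Num.min a b); first by rewrite lt_min a0.
rewrite lt_min => /andP[ea eb].
have [h [_ hE]] := PL_extend 0 ze za zb e0 ea eb.
have ha : h a = b by rewrite hE // subrr mulr0 addr0.
pose c := Num.max ((a + 1) / 2) ((b + 1) / 2).
have [||g [g1 g2]] := @PL_truncate R h a c za a0.
- by rewrite lt_max; apply/orP; left; lra.
- by rewrite ha lt_max; apply/orP; right; lra.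
exists g; last by rewrite g1.
exists c => //; rewrite gt_max; between.
Qed.

(** A conjugate of a local element brings the image of the base point back to
    it, unless this image is the one under the rotation; a local element
    moves it away in that case.  A map fixing the base point can be corrected
    by a local element to be trivial near the point [tau], and then its
    conjugate by the rotation is itself local. *)
Lemma Ttau_generated (r : Ttau R) (S : Ttau R -> Prop) :
  (forall x, val (r x) = if val x <= 1 - tau then val x + tau else val x + tau - 1) ->
  (forall f g, S f -> S g -> S (f * g)%g) -> (forall f, S f -> S (f^-1)%g) ->
  (forall h f, local h -> agree h f -> S f) ->
  (forall h f, local h -> agree h f -> S (f ^ r^-1)%g) -> forall f, S f.
Proof.
move=> rE SM SV Sl Sr.
have t0 := tau_gt0 R; have t1 := tau_lt1 R; have zt := Ztau_tau R; have z1 := Ztau1 R.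
have zt' : in_Ztau (1 - tau) by exact: ZtauB.
have rlo x : val x <= 1 - tau -> val (r x) = val x + tau by move=> xl; rewrite rE xl.
have rhi x : 1 - tau < val x -> val (r x) = val x + tau - 1.
  by move=> xl; rewrite rE leNgt xl.
have Sfix1 f : f itop = itop -> S f.
  move=> f1.
  have [|e [k [e0 eh fe]]] := @fix1_germ0 f (tau / 2) f1; first by between.
  have [v zv /andP[v0 ve]] := Ztau_dense e0.
  have [u zu /andP[u0]] : exists2 u, in_Ztau u & 0 < u < Num.min v (tau ^ k * v).
    by apply: Ztau_dense; rewrite lt_min v0 mulr_gt0 ?tauX_gt0.
  rewrite lt_min => /andP[uv ukv].
  have zkv : in_Ztau (tau ^ k * v) by apply: ZtauM => //; exact: Ztau_tauX.
  have [h0 [_ h0E]] := PL_extend 0 zu zv zkv u0 uv ukv.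
  have [x xv|h [_ hE]] := @fix1_PL f h0 v f1 zv v0.
    by rewrite fe ?xv 1?ltW // h0E // subrr mulr0 addr0.
  have [b zb /andP[tb b1]] := Ztau_dense t1.
  have b0 : 0 < b by lra.
  have b01 : 0 < b <= 1 by between.
  have hb : h b < 1.
    have := hE (pt b01); rewrite ptE => <-; last by lra.
    by have := fix1_mono f1 (_ : val (pt b01) < val itop); rewrite f1 !ptE; exact.
  have [||g [g1 g2]] := @PL_truncate R h b (Num.max ((b + 1) / 2) ((h b + 1) / 2)) zb b0.
  - by rewrite lt_max; apply/orP; left; lra.
  - by rewrite lt_max; apply/orP; right; lra.
  have gl : local g.
    by exists (Num.max ((b + 1) / 2) ((h b + 1) / 2)) => //; rewrite gt_max; between.
  have [fg fgE] := agree_exists (local_fix1 gl).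
  have -> : f = (fg * (((fg^-1 * f) ^ r) ^ r^-1))%g by rewrite conjgK mulKVg.
  apply: SM; first exact: Sl fgE.
  have idm x : v <= val x -> val x <= b -> (fg^-1 * f)%g x = x.
    move=> vx xb; apply: (can_inj (TtauK fg)); rewrite TtauM TtauVK; apply: val_inj.
    by rewrite fgE g1 // hE.
  have idr x : v <= val (r x) -> val (r x) <= b -> ((fg^-1 * f) ^ r)%g x = x.
    by move=> h1 h2; rewrite TtauJ idm // TtauK.
  have [|||||h' h'l h'E] := @fix1_near1_local ((fg^-1 * f) ^ r)%g
    (Num.min (1 - tau) (b - tau)) (1 + v - tau).
  - by apply: idr; rewrite rhi ptE; lra.
  - by rewrite lt_min; between.
  - by lra.
  - move=> x; rewrite le_min => /andP[x1 x2]; have x0 := I_gt0 x.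
    by apply: idr; rewrite rlo //; lra.
  - move=> x xw; have x1 := I_le1 x.
    by apply: idr; rewrite rhi; lra.
  exact: Sr h'l h'E.
have Sne f : val (f itop) != tau -> S f.
  move=> ft; have [p1|p1] := eqVneq (val (f itop)) 1; first exact/Sfix1/itopE.
  set p := val (f itop) in ft p1 *; have zp : in_Ztau p := Ttau_top f.
  have p0 : 0 < p := I_gt0 _; have p1' : p < 1 by rewrite lt_neqAle p1 I_le1.
  have [w [w01 zw rw]] : exists w : I, [/\ val w < 1, in_Ztau (val w) & r w = f itop].
    case: (ltgtP p tau) ft => // ptau _.
      have w01 : 0 < p + 1 - tau <= 1 by between.
      exists (pt w01); split; rewrite ?ptE; first by lra.
        by apply: ZtauB => //; exact: ZtauD.
      by apply: val_inj; rewrite rhi ptE -/p; lra.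
    have w01 : 0 < p - tau <= 1 by between.
    exists (pt w01); split; rewrite ?ptE; [by lra|exact: ZtauB|].
    by apply: val_inj; rewrite rlo ptE -/p; lra.
  have [||h hl hw] := @local_move (1 - tau) (val w) zt' zw.
  - by between.
  - by rewrite I_gt0.
  have [g gE] := agree_exists (local_fix1 hl).
  have -> : f = ((g ^ r^-1) * ((g ^ r^-1)^-1 * f))%g by rewrite mulKVg.
  apply: (SM _ _ (Sr _ _ hl gE)); apply: Sfix1.
  rewrite TtauM; apply: (can_inj (TtauK (g ^ r^-1)%g)); rewrite TtauVK -rw.
  rewrite TtauJ invgK; congr (r _); apply: val_inj; rewrite gE -hw; congr (h _).
  have := TtauVK r itop; set y := (r^-1)%g itop => /(congr1 val); rewrite rE !ptE.
  have y0 := I_gt0 y; have y1 := I_le1 y.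
  by case: (leP (val y) (1 - tau)) => _; lra.
move=> f; have [ft|/Sne //] := eqVneq (val (f itop)) tau.
have [||h hl ht] := @local_move tau (1 - tau) zt zt'; try by between.
have [g gE] := agree_exists (local_fix1 hl).
have -> : f = (g^-1 * (g * f))%g by rewrite mulKg.
apply: SM; first exact/SV/(Sl _ _ hl).
apply: Sne; rewrite TtauM gE ft ht; have := tau_sqr R; apply: contra_eqN => /eqP tt.
by apply/eqP; nra.
Qed.

End Monotone.

(** * Normal subgroups *)

Section Supports.
Variable R : realType.
Local Notation tau := (tau R).
Local Notation I := (unitI R).
Implicit Types (f g : Ttau R) (h k l : PL R) (x y z : I) (A B : I -> Prop).

Definition supported f A := forall x, ~ A x -> f x = x.

Lemma supported_sub f A B : supported f A -> (forall x, A x -> B x) -> supported f B.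
Proof. by move=> fA AB x nB; apply: fA => /AB. Qed.

Lemma supportedM f g A : supported f A -> supported g A -> supported (f * g)%g A.
Proof. by move=> fA gA x nA; rewrite TtauM gA ?fA. Qed.

Lemma supportedV f A : supported f A -> supported (f^-1)%g A.
Proof. by move=> fA x nA; apply: (can_inj (TtauK f)); rewrite TtauVK fA. Qed.

Lemma supportedJ f g A : supported f A -> supported (f ^ g)%g (fun x => A (g x)).
Proof. by move=> fA x nA; rewrite TtauJ fA // TtauK. Qed.

Lemma supported_im f A x : supported f A -> A x -> A (f x).
Proof.
move=> fA Ax; case: (pselect (A (f x))) => // nA.
by have := fA _ nA => /(can_inj (TtauK f)) fx; rewrite fx in nA.
Qed.

Lemma disjoint_commute f g A B : supported f A -> supported g B ->
  (forall x, A x -> ~ B x) -> commute f g.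
Proof.
move=> fA gB AB; apply: Ttau_ext => x; rewrite !TtauM.
case: (pselect (A x)) => Ax.
  by rewrite (gB _ (AB _ Ax)) (gB _ (AB _ (supported_im fA Ax))).
rewrite (fA _ Ax); case: (pselect (B x)) => Bx; last by rewrite !gB ?fA.
by apply: fA => /AB; apply; exact: supported_im gB Bx.
Qed.

Definition itv (p q : R) x := p < val x < q.

Lemma itv_disjoint (p q p' q' : R) : q <= p' -> forall x, itv p q x -> ~ itv p' q' x.
Proof. by move=> qp x /andP[_ h1] /andP[h2 _]; lra. Qed.

Lemma local_supported h f : local h -> agree h f ->
  exists e b : R, [/\ 0 < e, b < 1 & supported f (itv e b)].
Proof.
move=> [b b1 hb] hf; have [e [_ e0 he]] := PL_id_near0 h.
exists e, b; split=> // x /negP; rewrite /itv negb_and -!leNgt => xP.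
by apply: val_inj; rewrite hf; case/orP: xP => [/he|/hb].
Qed.

Lemma agree_uniq h f g : agree h f -> agree h g -> f = g.
Proof. by move=> hf hg; apply: Ttau_ext => x; apply: val_inj; rewrite hf hg. Qed.

Lemma local_squeeze (e b p q : R) : 0 < e -> b < 1 -> 0 <= p -> p < q -> q <= 1 ->
  exists2 h, local h & forall t, e <= t -> t <= b -> p < h t < q.
Proof.
move=> e0 b1 p0 pq q1.
have [|e' ze /andP[e'0]] := @Ztau_dense R 0 (Num.min e 1); first by rewrite lt_min e0 ltr01.
rewrite lt_min => /andP[e'e e'1].
have [|b' zb /andP[]] := @Ztau_dense R (Num.max e' b) 1; first by rewrite gt_max e'1.
rewrite gt_max => /andP[eb' bb'] b'1.
have [p' zp /andP[pp' p'q]] := Ztau_dense pq.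
have [|u zu /andP[u0]] := @Ztau_dense R 0 (Num.min e' p'); first by rewrite lt_min e'0 /=; lra.
rewrite lt_min => /andP[ue up].
have [j jP] : exists j : nat, tau ^+ j < (q - p') / (b' - e').
  by apply: tauX_small; rewrite divr_gt0 ?subr_gt0.
rewrite ltr_pdivlMr ?subr_gt0 // in jP.
have [h [_ hE]] := PL_extend j zu ze zp u0 ue up.
have hb : h b' < q by rewrite hE ?ltW // -ltrBrDl.
pose c := Num.max ((b' + 1) / 2) ((h b' + 1) / 2).
have [|||g [g1 g2]] := @PL_truncate R h b' c zb.
- by lra.
- by rewrite lt_max; apply/orP; left; lra.
- by rewrite lt_max; apply/orP; right; lra.
exists g; first by exists c => //; rewrite gt_max; between.
move=> t et tb; rewrite g1; last by lra.
have hlt : h t < h b' by rewrite PL_ltE; lra.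
have : h e' < h t by rewrite PL_ltE; lra.
by rewrite hE // subrr mulr0 addr0 => ?; between.
Qed.

Lemma squeeze_supported (e b p q : R) : 0 < e -> b < 1 -> 0 <= p -> p < q -> q <= 1 ->
  exists g : Ttau R, forall f, supported f (itv e b) ->
    supported (f ^ g^-1)%g (itv p q).
Proof.
move=> e0 b1 p0 pq q1; have [h hl hP] := local_squeeze e0 b1 p0 pq q1.
have [g gE] := agree_exists (local_fix1 hl); exists g => f' fs.
apply: (supported_sub (supportedJ fs (g:=(g^-1)%g))) => x /andP[h1 h2].
by rewrite /itv -{1 2}(TtauVK g x) gE hP ?ltW.
Qed.

Lemma displaced_interval f : f <> 1%g -> exists p q : R,
  [/\ 0 <= p, p < q, q <= 1 & forall x, itv p q x -> ~ itv p q (f x)].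
Proof.
move=> f1; have [x fx] : exists x, f x <> x.
  by apply: contrapT => h; apply/f1/Ttau_ext => x; apply: contrapT => fx; apply: h; exists x.
have [[_ [s [zs sP]]] _ _] := Ttau_in f.
have [u [u0 ux av]] := prev_point s (I_gt0 x).
have [k [c fE]] := sP u (val x) u0 ux (I_le1 x) av.
have t0 := tauX_gt0 R k.
have fxE : val (f x) = tau ^ k * val x + c by rewrite fE ?ux ?lexx.
have x1 := I_le1 x.
case: (ltgtP (val (f x)) (val x)) => [lt|gt|/val_inj//].
  exists (Num.max u (val (f x))), (val x); split=> //.
  - by rewrite le_max u0.
  - by rewrite gt_max ux.
  move=> y /andP[]; rewrite /itv gt_max => /andP[uy _] yx /andP[+ _].
  rewrite gt_max fE ?uy ?ltW // fxE => /andP[_].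
  by rewrite ltrD2r ltr_pM2l //; lra.
exists (Num.max u (val x - (val (f x) - val x) / tau ^ k)), (val x); split=> //.
- by rewrite le_max u0.
- by rewrite gt_max ux ltrBlDr ltrDl divr_gt0 // subr_gt0.
move=> y /andP[]; rewrite /itv gt_max => /andP[uy +] yx /andP[_].
rewrite ltrBlDr -ltrBlDl ltr_pdivlMr // mulrC mulrBr => h1.
by rewrite fE ?uy ?ltW //; lra.
Qed.

End Supports.

Section Commutators.
Local Open Scope group_scope.
Variable gT : groupType.
Implicit Types a b x y : gT.

Lemma commg_mul_commute a b x : commute x a -> commute x b -> [~ a * x, b] = [~ a, b].
Proof.
move=> xa xb; have fixg y z : commute y z -> y ^ z = y by move=> /commgP/conjg_fixP.
have -> : [~ a * x, b] = [~ a, b] ^ x.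
  by rewrite commgEl conjMg (fixg x b) // invMg [RHS]conjgE commgEl !mulgA.
by rewrite conjRg !fixg //; exact: commute_sym.
Qed.

Lemma commg_mul_commute2 a b x y : commute x a -> commute x b -> commute y a ->
  commute y b -> commute x y -> [~ a * x, b * y] = [~ a, b].
Proof.
move=> xa xb ya yb xy; rewrite commg_mul_commute //; last exact: commuteM.
by rewrite -invgR commg_mul_commute ?invgR //.
Qed.

End Commutators.

Section CommutatorTrick.
Variable R : realType.
Local Notation tau := (tau R).
Local Notation I := (unitI R).
Implicit Types (f g : Ttau R) (h k l : PL R) (x y z : I).
Variable phi : Ttau R -> 'Z_2.
Hypothesis phiM : forall f g : Ttau R, phi (f * g)%g = phi f + phi g.
Hypothesis phi_surj : forall z : 'Z_2, exists f : Ttau R, phi f = z.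

Lemma Z2P (z : 'Z_2) : z = 0 \/ z = 1.
Proof. by case: z => [[|[|//]]] hz; [left | right]; apply: val_inj. Qed.

Lemma Z2D (z : 'Z_2) : z + z = 0.
Proof. by case: (Z2P z) => ->; apply: val_inj. Qed.

Lemma phi1 : phi 1%g = 0.
Proof. by apply: (addrI (phi 1%g)); rewrite -phiM mulg1 addr0. Qed.

Lemma phiV f : phi (f^-1)%g = phi f.
Proof. by apply: (addrI (phi f)); rewrite -phiM mulgV phi1 Z2D. Qed.

Lemma phiJ f g : phi (f ^ g)%g = phi f.
Proof. by rewrite conjgE !phiM phiV addrCA Z2D addr0. Qed.

Lemma kernel_group : group_closed (Txz phi).
Proof.
split; first by rewrite inE phi1.
by move=> f g; rewrite !inE phiM phiV => /eqP -> /eqP ->; rewrite addr0.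
Qed.

Lemma local_phi1 : exists h f, [/\ local h, agree h f & phi f = 1].
Proof.
apply: contrapT => no; have loc0 h f : local h -> agree h f -> phi f = 0.
  by move=> hl hf; case: (Z2P (phi f)) => // pf; case: no; exists h, f.
have [r rE] := rotation_exists R; have [f fE] := phi_surj 1.
suff : phi f = 0 by rewrite fE => /eqP.
apply: (Ttau_generated rE (S := fun f => phi f = 0)) => [f' g|f'|h f'|h f' hl hf].
- by rewrite phiM => -> ->; rewrite addr0.
- by rewrite phiV.
- exact: loc0.
- by rewrite phiJ; exact: loc0 hl hf.
Qed.

(** If [n] displaces an interval in which [a'] and [b'] are supported then
    [a'^-1] conjugated by [n] commutes with both, so [[a', b']] is a product of
    conjugates of [n] and its inverse by elements of the kernel, provided that
    [a'] and [b'] are in the kernel.  To ensure this, the copies of [a] and [b]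
    squeezed in the interval are multiplied by copies of their inverses with
    disjoint supports, which does not change the commutator.  In the same way
    the conjugating element is corrected by an element [u] of disjoint support
    with [phi u = 1]. *)
Lemma local_commutators (N : {pred Ttau R}) (n : Ttau R) : normal_in N (Txz phi) ->
  n \in N -> n <> 1%g -> forall (h h' : PL R) (a b f : Ttau R),
  local h -> agree h a -> local h' -> agree h' b -> ([~ a, b] ^ f)%g \in N.
Proof.
move=> [Ng NK NJ] nN n1 h h' a b f hl ha h'l h'b.
have [p [q [p0 pq q1 disp]]] := displaced_interval n1.
have [e1 [c1 [e10 c11 as1]]] := local_supported hl ha.
have [e2 [c2 [e20 c21 bs1]]] := local_supported h'l h'b.
have [hu [u0 [hul hu0 phiu0]]] := local_phi1.
have [e3 [c3 [e30 c31 us1]]] := local_supported hul hu0.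
pose e := Num.min e1 (Num.min e2 e3); pose c := Num.max c1 (Num.max c2 c3).
have e0 : 0 < e by rewrite !lt_min e10 e20.
have c1' : c < 1 by rewrite !gt_max c11 c21.
have [ee1 ee2 ee3] : [/\ e <= e1, e <= e2 & e <= e3].
  by rewrite /e !ge_min !lexx !orbT.
have [cc1 cc2 cc3] : [/\ c1 <= c, c2 <= c & c3 <= c].
  by rewrite /c !le_max !lexx !orbT.
have widen e' c' g : e <= e' -> c' <= c -> supported g (itv e' c') -> supported g (itv e c).
  move=> he hc gs; apply: (supported_sub gs) => x /andP[? ?]; rewrite /itv; between.
have as' := widen _ _ _ ee1 cc1 as1; have bs' := widen _ _ _ ee2 cc2 bs1.
have us' := widen _ _ _ ee3 cc3 us1.
(* The copies of [a] and [b], of [a^-1] and [u], and of [b^-1] are squeezed in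
   the three thirds of the interval. *)
pose p1 := p + (q - p) / 3; pose p2 := p + (q - p) * 2 / 3.
have [pp1 p12 p2q] : [/\ p < p1, p1 < p2 & p2 < q] by rewrite /p1 /p2; split; lra.
have [p1_1 p1_0 p2_1 p2_0] : [/\ p1 <= 1, 0 <= p1, p2 <= 1 & 0 <= p2] by split; lra.
have [k kP] := squeeze_supported e0 c1' p0 pp1 p1_1.
have [t tP] := squeeze_supported e0 c1' p1_0 p12 p2_1.
have [s sP] := squeeze_supported e0 c1' p2_0 p2q q1.
pose a1 := (a ^ k^-1)%g; pose b1 := (b ^ k^-1)%g.
pose a2 := ((a^-1) ^ t^-1)%g; pose b3 := ((b^-1) ^ s^-1)%g; pose u := (u0 ^ t^-1)%g.
have a1s : supported a1 (itv p p1) by exact: kP.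
have b1s : supported b1 (itv p p1) by exact: kP.
have a2s : supported a2 (itv p1 p2) by exact/tP/supportedV.
have us : supported u (itv p1 p2) by exact: tP.
have b3s : supported b3 (itv p2 q) by exact/sP/supportedV.
pose a' := (a1 * a2)%g; pose b' := (b1 * b3)%g.
have ra' : [~ a', b']%g = [~ a1, b1]%g.
  apply: commg_mul_commute2.
  - by apply/commute_sym/(disjoint_commute a1s a2s)/itv_disjoint.
  - by apply/commute_sym/(disjoint_commute b1s a2s)/itv_disjoint.
  - by apply/commute_sym/(disjoint_commute a1s b3s)/itv_disjoint/ltW.
  - by apply/commute_sym/(disjoint_commute b1s b3s)/itv_disjoint/ltW.
  - by apply/(disjoint_commute a2s b3s)/itv_disjoint.
have grow (p' q' : R) g : p <= p' -> q' <= q ->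
    supported g (itv p' q') -> supported g (itv p q).
  move=> he hc gs; apply: (supported_sub gs) => x /andP[? ?]; rewrite /itv; between.
have a's : supported a' (itv p q).
  by apply: supportedM; [apply: (grow _ _ _ _ _ a1s) | apply: (grow _ _ _ _ _ a2s)]; lra.
have b's : supported b' (itv p q).
  by apply: supportedM; [apply: (grow _ _ _ _ _ b1s) | apply: (grow _ _ _ _ _ b3s)]; lra.
have a'K : a' \in Txz phi by rewrite inE /a' phiM !phiJ phiV Z2D.
have b'K : b' \in Txz phi by rewrite inE /b' phiM !phiJ phiV Z2D.
have NV := group_closedV Ng; have NM := group_closedM Ng.
have comN (x y : Ttau R) : x \in N -> y \in Txz phi -> [~ x, y]%g \in N.
  by move=> xN yK; rewrite commgEl; apply: NM; [exact: NV | exact: NJ].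
have rN : [~ a1, b1]%g \in N.
  have a'VK := group_closedV kernel_group a'K.
  have : [~ [~ a'^-1, n], b']%g \in N.
    by apply: (comN _ _) => //; rewrite -invgR; apply: (NV _); exact: comN.
  rewrite (commgEl (a'^-1)%g) invgK conjVg commg_mul_commute ?ra' //.
    exact/commute_sym/commuteV/(disjoint_commute a's (supportedJ (g:=n) a's))/disp.
  exact/commute_sym/commuteV/(disjoint_commute b's (supportedJ (g:=n) a's))/disp.
have -> : ([~ a, b] ^ f)%g = ([~ a1, b1] ^ (k * f))%g.
  by rewrite /a1 /b1 -conjRg -conjgM mulgA mulVg mul1g.
case: (Z2P (phi (k * f)%g)) => pf; first by apply: NJ => //; rewrite inE pf.
have uc : ([~ a1, b1] ^ u)%g = [~ a1, b1]%g.
  have uf g : supported g (itv p p1) -> (g ^ u)%g = g.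
    by move=> gs; apply/conjg_fixP/commgP/(disjoint_commute gs us)/itv_disjoint.
  by rewrite conjRg !uf.
rewrite -uc -conjgM; apply: NJ => //; rewrite inE phiM pf phiJ phiu0; exact/eqP/Z2D.
Qed.

End CommutatorTrick.

Section IndexTwoInTtau.
Variable R : realType.
Local Notation tau := (tau R).
Local Notation I := (unitI R).
Implicit Types (f g : Ttau R) (h k l : PL R) (x y z : I).

Lemma conj_agree h l l' (b : R) : (forall t, b <= t -> h t = t) ->
  (forall t, t <= b -> l t = l' t) -> (h ^ l^-1)%g = (h ^ l'^-1)%g.
Proof.
move=> hb ll'; apply: PL_ext => x; rewrite !PLJ !invgK.
have hle t : t <= b -> h t <= b by move=> tb; rewrite -(hb b) // PL_leE.
case: (leP x (l b)) => xb.
  have e1 : (l^-1)%g x <= b by rewrite -(PL_leE l) PLVK.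
  have e2 : (l^-1)%g x = (l'^-1)%g x by apply: (can_inj (PLK l')); rewrite PLVK -ll' // PLVK.
  by rewrite -e2 ll' // hle.
have out (m : PL R) : m b < x -> m (h ((m^-1)%g x)) = x.
  by move=> mb; rewrite hb ?PLVK // -(PL_leE m) PLVK ltW.
by rewrite !out // -ll'.
Qed.

Lemma PL_shrink (b e : R) : 0 < e -> exists h : PL R, h b < e.
Proof.
move=> e0; have [v zv /andP[]] := @Ztau_dense R (Num.max b e) (Num.max b e + 1) (ltac:(lra)).
rewrite gt_max => /andP[bv ev] _.
have [w zw /andP[w0 we]] := Ztau_dense e0.
have [u zu /andP[u0 uw]] := Ztau_dense w0.
have [|h [_ hE]] := PL_extend 0 zu zv zw u0 _ uw; first by lra.
exists h; apply: lt_trans we; apply: (@lt_le_trans _ _ (h v)); first by rewrite PL_ltE.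
by rewrite hE // subrr mulr0 addr0.
Qed.

Lemma compact_bound h : compact_supp h -> exists b : R, forall t, b <= t -> h t = t.
Proof. by move=> [_ [b hb]]; exists b => t /hb ->; rewrite expr0z mul1r addr0. Qed.

Lemma bound_compact h (b : R) : (forall t, b <= t -> h t = t) -> compact_supp h.
Proof.
move=> hb; split; first exact: Ztau0.
by exists b => t /hb ->; rewrite expr0z mul1r addr0.
Qed.

(** How a compactly supported [h], whose support may leave the interval, is seen
    in the circle group.  By [placed_conj] the choice of [k] only matters up to
    conjugacy. *)
Definition placed h k f := (exists2 b : R, (forall t, b <= t -> h t = t) & k b < 1) /\
  agree (h ^ k^-1)%g f.

Lemma conj_bound h k (b : R) : (forall t, b <= t -> h t = t) ->
  forall t, k b <= t -> (h ^ k^-1)%g t = t.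
Proof.
move=> hb t bt; rewrite PLJ invgK hb ?PLVK //.
by rewrite -(PL_leE k) PLVK.
Qed.

Lemma placed_exists h k (b : R) : (forall t, b <= t -> h t = t) -> k b < 1 ->
  local (h ^ k^-1)%g /\ exists f, placed h k f.
Proof.
move=> hb kb; have hl : local (h ^ k^-1)%g by exists (k b) => //; exact: conj_bound.
split=> //; have [f fE] := agree_exists (local_fix1 hl).
by exists f; split=> //; exists b.
Qed.

Lemma local_placed h f : local h -> agree h f -> placed h 1%g f.
Proof. by move=> [b b1 hb] hf; split; [exists b | rewrite invg1 conjg1]. Qed.

(** On the support of the conjugate of [h] by [k], the map [k' * k^-1] agrees
    with a local element. *)
Lemma placed_conj h k k' f f' : placed h k f -> placed h k' f' ->
  exists2 g, (exists2 l, local l & agree l g) & f' = (f ^ g)%g.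
Proof.
move=> [[b hb kb] hf] [[b' hb' kb'] hf'].
pose m := Num.min b b'.
have hm t : m <= t -> h t = t by rewrite ge_min => /orP[/hb|/hb'].
have km : k m < 1 by apply: le_lt_trans kb; rewrite PL_leE ge_min lexx.
have km' : k' m < 1 by apply: le_lt_trans kb'; rewrite PL_leE ge_min lexx orbT.
pose l := (k' * k^-1)%g.
have [|c zc /andP[]] := @Ztau_dense R (Num.max 0 (k m)) (Num.min 1 ((l^-1)%g 1)).
  rewrite gt_max !lt_min ltr01 km PL_gt0 ltr01 /=.
  by rewrite -(PL_ltE l) PLVK PLM PLK.
rewrite gt_max lt_min => /andP[c0 kmc] /andP[c1 lc].
have {}lc : l c < 1 by rewrite -(PLVK l 1) PL_ltE.
have [||l' [l'1 l'2]] := @PL_truncate R l c (Num.max ((c + 1) / 2) ((l c + 1) / 2)) zc c0.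
- by rewrite lt_max; apply/orP; left; lra.
- by rewrite lt_max; apply/orP; right; lra.
have ll : local l'.
  by exists (Num.max ((c + 1) / 2) ((l c + 1) / 2)) => //; rewrite gt_max; between.
have [g gE] := agree_exists (local_fix1 ll).
exists (g^-1)%g; first by exists (l'^-1)%g; [exact: localV | exact: agreeV].
apply: (agree_uniq hf').
have := agreeJ hf (agreeV gE).
rewrite (@conj_agree _ l' l c) //; last first.
  by move=> t ct; apply: (conj_bound hm); lra.
by rewrite -conjgM /l invMg invgK mulKg.
Qed.

(** The compactly supported [h] that fall in [M] once placed in the interval form
    a normal subgroup [Z] to which [compact_mod_two] applies: given a compactly
    supported [h], any [g] agrees with a compactly supported map on the support
    of [h], so that [[h, g]] becomes a commutator of local elements. *)
Lemma index_two (M : {pred Ttau R}) : group_closed M ->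
  (forall g f, f \in M -> (f ^ g)%g \in M) ->
  (forall h h' f f', local h -> agree h f -> local h' -> agree h' f' -> [~ f, f']%g \in M) ->
  exists c, forall f, f \in M \/ (c^-1 * f)%g \in M.
Proof.
move=> Mg MJ Mloc.
have MM := group_closedM Mg; have MV := group_closedV Mg.
pose Z : {pred PL R} := [pred h | `[< compact_supp h /\ forall k f, placed h k f -> f \in M >]].
have ZP h : h \in Z <-> compact_supp h /\ forall k f, placed h k f -> f \in M.
  by split=> [/asboolP//|?]; apply/asboolP.
have ZE h k f : placed h k f -> (h \in Z <-> f \in M).
  move=> pf; split=> [/ZP[_]|fM]; first by apply; exact: pf.
  apply/ZP; split; first by have [[b hb _] _] := pf; exact: bound_compact hb.
  by move=> k' f' /(placed_conj pf)[g _ ->]; exact: MJ.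
have two h h' : compact_supp h -> compact_supp h' -> exists b : R,
    (forall t, b <= t -> h t = t) /\ (forall t, b <= t -> h' t = t).
  move=> /compact_bound[b hb] /compact_bound[b' hb']; exists (Num.max b b').
  by split=> t; rewrite ge_max => /andP[? ?]; [exact: hb | exact: hb'].
have Zg : group_closed Z.
  split.
    apply/(ZE 1%g 1%g 1%g); last exact: Mg.1.
    by split; [exists 0; rewrite ?PL1 | move=> x; rewrite Ttau1 conj1g PL1].
  move=> h h' /[dup] hZ /ZP[hc _] /[dup] h'Z /ZP[h'c _].
  have [b [hb h'b]] := two _ _ hc h'c; have [k kb] := PL_shrink b ltr01.
  have [_ [f fP]] := placed_exists hb kb; have [_ [f' f'P]] := placed_exists h'b kb.
  apply/(ZE _ k (f * f'^-1)%g).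
    split; last by rewrite conjMg conjVg; exact: agreeM fP.2 (agreeV f'P.2).
    exists b => // t bt; rewrite PLM; have -> : (h'^-1)%g t = t; last exact: hb.
    by apply: (can_inj (PLK h')); rewrite PLVK h'b.
  by apply: MM; [exact/(ZE _ _ _ fP) | exact/MV/(ZE _ _ _ f'P)].
have ZJ (g h : PL R) : h \in Z -> (h ^ g)%g \in Z.
  move=> /[dup] hZ /ZP[/compact_bound[b hb] _]; have [k kb] := PL_shrink b ltr01.
  have [_ [f fP]] := placed_exists hb kb.
  apply/(ZE _ (k * g)%g f); last exact/(ZE _ _ _ fP).
  split; last by rewrite -conjgM invMg mulVKg; exact: fP.2.
  exists ((g^-1)%g b); last by rewrite PLM PLVK.
  by move=> t; have := @conj_bound h (g^-1)%g b hb t; rewrite invgK.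
have Zc (h g : PL R) : compact_supp h -> [~ h, g]%g \in Z.
  move=> /compact_bound[b0 hb0].
  have [b zb /andP[]] := @Ztau_dense R (Num.max 0 b0) (Num.max 0 b0 + 1) (ltac:(lra)).
  rewrite gt_max => /andP[bgt0 b0b] _.
  have hb t : b <= t -> h t = t by move=> bt; apply: hb0; lra.
  have [||l [l1 l2]] := @PL_truncate R (g^-1)%g b (Num.max b ((g^-1)%g b) + 1) zb bgt0.
  - by rewrite ltr_pwDr // le_max lexx.
  - by rewrite ltr_pwDr // le_max lexx orbT.
  have -> : [~ h, g]%g = [~ h, l^-1]%g.
    by rewrite !commgEl (conj_agree hb l1) invgK.
  have lc : compact_supp l^-1%g.
    by have := germV0 (bound_compact l2); rewrite oppr0.
  have [c [hc lc']] := two _ _ (bound_compact hb) lc.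
  have [k kc] := PL_shrink c ltr01.
  have [hl [f fP]] := placed_exists hc kc; have [ll [f' f'P]] := placed_exists lc' kc.
  apply/(ZE _ k [~ f, f']%g); last exact: Mloc hl fP.2 ll f'P.2.
  split; last first.
    by rewrite conjRg !commgEl; apply: agreeM (agreeV fP.2) (agreeJ fP.2 f'P.2).
  have hV t : c <= t -> (h^-1)%g t = t.
    by move=> ct; apply: (can_inj (PLK h)); rewrite PLVK hc.
  have lV t : c <= t -> (l^-1^-1)%g t = t.
    by move=> ct; apply: (can_inj (PLK l^-1%g)); rewrite PLVK lc'.
  by exists c => // t ct; rewrite commgEl PLM PLJ lc' // hc // lV // hV.
have [c [cc c2 cP]] := compact_mod_two Zg ZJ Zc.
have [b cb] := compact_bound cc.
have t0 := tau_gt0 R; have t1 := tau_lt1 R.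
(* The representative [c0] of [c] is supported so far from 1 that its conjugate
   by the rotation is local again. *)
have [|k kb] := @PL_shrink b (1 - tau); first by lra.
have kb1 : k b < 1 by lra.
have [c1l [c0 [_ c0E]]] := placed_exists cb kb1.
pose c1 := (c ^ k^-1)%g.
exists c0.
have c1P t : 1 - tau <= t -> c1 t = t.
  by move=> bt; apply: (conj_bound cb); lra.
have c1V h : compact_supp h -> h \in Z \/ (c1^-1 * h)%g \in Z.
  move=> /cP[|hZ]; [by left | right].
  have -> : (c1^-1 * h)%g = ([~ c, k^-1]^-1 * (c^-1 * h))%g.
    have gen (a b' h' : PL R) : (b'^-1 * h' = (a^-1 * b')^-1 * (a^-1 * h'))%g.
      by rewrite invMg invgK !mulgA mulgK.
    exact: gen.
  by apply: (group_closedM Zg) => //; apply: (group_closedV Zg); exact: Zc.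
have locM h f : local h -> agree h f -> f \in M \/ (c0^-1 * f)%g \in M.
  move=> hl hf; have [d _ hd] := hl; case: (c1V _ (bound_compact hd)) => hZ.
    by left; apply/(ZE _ _ _ (local_placed hl hf)).
  right; apply/(ZE _ _ _ (local_placed _ (agreeM (agreeV c0E) hf))) => //.
  by apply: localM => //; exact: localV.
have c02 : (c0 * c0)%g \in M.
  apply/(ZE _ _ _ (local_placed _ (agreeM c0E c0E))); first exact: localM.
  by rewrite -conjMg; exact: ZJ.
have [E [chi [chiM chiM1]]] := quotient_group_exists Mg MJ.
have chi1 : chi 1%g = 1%g by apply/chiM1; exact: Mg.1.
have chiV f : chi (f^-1)%g = ((chi f)^-1)%g.
  by apply: (@mulgI _ (chi f)); rewrite -chiM !mulgV.
have cM f : f \in M \/ (c0^-1 * f)%g \in M <-> chi f = 1%g \/ chi f = chi c0.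
  rewrite -!chiM1 chiM chiV; split=> -[->|]; try by left.
    by move=> e; right; apply: (@mulgI _ (chi c0)^-1%g); rewrite e mulVg.
  by move=> ->; right; rewrite mulVg.
have cc1 : (chi c0 * chi c0 = 1)%g by rewrite -chiM; apply/chiM1.
have cV : ((chi c0)^-1 = chi c0)%g by apply: (@mulgI _ (chi c0)); rewrite mulgV.
have [r rE] := rotation_exists R.
apply: (Ttau_generated rE) => [f g /cM fM /cM gM|f /cM fM|h f|h f hl hf].
- by apply/cM; rewrite chiM; case: fM => ->; case: gM => ->;
    rewrite ?mulg1 ?mul1g ?cc1; [left|right|right|left].
- by apply/cM; rewrite chiV; case: fM => ->; rewrite ?invg1 ?cV; [left|right].
- exact: locM.
have chiJ f' g : chi (f' ^ g)%g = (chi f' ^ chi g)%g by rewrite !conjgE !chiM chiV.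
apply/cM; rewrite chiJ; have /cM[->|->] := locM _ _ hl hf; first by left; rewrite conj1g.
rewrite -chiJ; apply/cM.
have rlo x : val x <= 1 - tau -> val (r x) = val x + tau by move=> xl; rewrite rE xl.
have rhi x : 1 - tau < val x -> val (r x) = val x + tau - 1.
  by move=> xl; rewrite rE leNgt xl.
have c0id x : k b <= val x -> c0 x = x.
  by move=> bx; apply: val_inj; rewrite c0E; apply: (conj_bound cb).
have rid x : k b <= val ((r^-1)%g x) -> (c0 ^ r^-1)%g x = x.
  by move=> bx; rewrite TtauJ invgK c0id // TtauVK.
have rV x : val x = val (r ((r^-1)%g x)) by rewrite TtauVK.
have low x : val x <= tau -> k b <= val ((r^-1)%g x).
  move=> xt; have := rV x; set y := (r^-1)%g x; have := I_gt0 y.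
  by case: (leP (val y) (1 - tau)) => [/[dup] /rlo ->|/[dup] /rhi ->]; lra.
have high x : k b + tau <= val x -> k b <= val ((r^-1)%g x).
  move=> xt; have := rV x; set y := (r^-1)%g x; have := I_gt0 y.
  by case: (leP (val y) (1 - tau)) => [/[dup] /rlo ->|/[dup] /rhi ->]; lra.
have [|||||h' h'l h'E] := @fix1_near1_local R (c0 ^ r^-1)%g tau (k b + tau).
- by apply/rid/high; rewrite ptE; lra.
- by [].
- by lra.
- by move=> x /low/rid.
- by move=> x /high/rid.
exact: locM h'l h'E.
Qed.

End IndexTwoInTtau.

Theorem theorem3p2 (R : realType) (phi : Ttau R -> 'Z_2)
  (phiM : forall f g : Ttau R, phi (f * g)%g = phi f + phi g)
  (phi_surj : forall z : 'Z_2, exists f : Ttau R, phi f = z)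
  (phi_x : forall (n : nat) (f : Ttau R), is_x n f -> phi f = 0)
  (phi_y : forall (n : nat) (f : Ttau R), is_y n f -> phi f = 1)
  (phi_c : forall (n : nat) (f : Ttau R), (1 <= n)%N -> is_c n f -> phi f = 0) :
  simple_subgroup (Txz phi).
Proof.
split; first exact: kernel_group.
  (* The square of a map moving [1 - tau] to [tau > 1 - tau] moves it further. *)
  have t0 := tau_gt0 R; have t1 := tau_lt1 R; have t2 := tau_sqr R.
  have zt := Ztau_tau R; have zt' : in_Ztau (1 - tau R) by exact: ZtauB (Ztau1 R) zt.
  have [||h hl ht] := local_move zt' zt; try by apply/andP; split; lra.
  have [f fE] := agree_exists (local_fix1 hl).
  move=> /(_ (f * f)%g); rewrite !inE phiM Z2D eqxx => /esym/eqP ff.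
  have t01 : 0 < 1 - tau R <= 1 by apply/andP; split; lra.
  have := congr1 (fun g : Ttau R => val (g (pt t01))) ff.
  rewrite TtauM !fE !ptE ht.
  have lt : 1 - tau R < tau R by rewrite -t2; nra.
  have : h (1 - tau R) < h (tau R) by rewrite PL_ltE.
  by rewrite ht; lra.
move=> N NN; have [Ng NK NJ] := NN.
case: (pselect (exists2 n, n \in N & n <> 1%g)) => [[n nN n1]|no]; last first.
  left=> f; rewrite inE; apply/idP/eqP => [fN|->]; last exact: Ng.1.
  by apply: contrapT => f1; apply: no; exists f.
right=> f; apply/idP/idP; first exact: NK.
have comN := local_commutators phiM phi_surj NN nN n1.
pose M : {pred Ttau R} := [pred g | `[< forall k, (g ^ k)%g \in N >]].
have MP g : g \in M <-> forall k, (g ^ k)%g \in N by split=> [/asboolP|?] //; apply/asboolP.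
have MN g : g \in M -> g \in N by move=> /MP/(_ 1%g); rewrite conjg1.
have [||| c cM] := @index_two R M.
- split; first by apply/MP => k; rewrite conj1g; exact: Ng.1.
  by move=> g g' /MP gM /MP gM'; apply/MP => k; rewrite conjMg conjVg; apply: Ng.2.
- by move=> k g /MP gM; apply/MP => k'; rewrite -conjgM.
- by move=> h h' g g' hl hg hl' hg'; apply/MP => k; exact: comN hl hg hl' hg'.
move=> fK; case: (cM f) => [/MN //|/MN/NK cf].
have c0 : phi c = 0.
  by move: fK cf; rewrite !inE => /eqP pf /eqP; rewrite phiM (phiV phiM) pf addr0.
have [g g1] := phi_surj 1; exfalso.
have : phi g = 0.
  by case: (cM g) => /MN/NK; rewrite inE ?phiM ?(phiV phiM) ?c0 ?add0r => /eqP.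
by rewrite g1 => /eqP.
Qed.
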